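(* Let $K$ be a quartic number field of signature $(2,1)$ (two real embeddings and one pair of complex conjugate embeddings). Then all $\alpha\in K$ are preperiodic under iteration of the Mahler measure $M$ if and only if the Galois group over $\mathbb{Q}$ of the Galois closure of $K$ is isomorphic to the dihedral group $D_4$. In all other cases $K$ contains wandering algebraic units.
   Context: $D_4$ is the dihedral group of order $8$. Fix an algebraic closure $\overline{\mathbb{Q}}\subseteq\mathbb{C}$ of $\mathbb{Q}$; number fields are subfields of $\overline{\mathbb{Q}}$. For $\alpha\in\overline{\mathbb{Q}}$ with (primitive) minimal polynomial $f(x)=a_nx^n+\cdots+a_0=a_n(x-\alpha_1)\cdots(x-\alpha_n)\in\mathbb{Z}[x]$ (so $f$ is irreducible in $\mathbb{Z}[x]$), the Mahler measure of $\alpha$ is $M(\alpha)=|a_n|\prod_{i=1}^n\max\{1,|\alpha_i|\}$. This is again an algebraic number, so $M$ is a map $\overline{\mathbb{Q}}\to\overline{\mathbb{Q}}$. Put $M^0(\alpha)=\alpha$ and $M^n(\alpha)=M(M^{n-1}(\alpha))$ for $n\ge1$. The point $\alpha$ is preperiodic (under iteration of $M$) if its forward orbit $\{M^n(\alpha):n\ge0\}$ is finite, and wandering if this orbit is infinite. An algebraic unit in $K$ is a unit of the ring of integers of $K$. *)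

(* Defs.v *)
From HB Require Import structures.
From mathcomp Require Import all_boot all_order all_algebra.
From mathcomp Require Import all_fingroup all_solvable all_field.

Set Implicit Arguments.
Unset Strict Implicit.
Unset Printing Implicit Defensive.

Import Order.TTheory GRing.Theory Num.Theory.
Local Open Scope ring_scope.

(* The algebraic closure of Q inside C is algC. *)

Definition minQpoly (a : algC) : {poly rat} := sval (minCpolyP a).

(* The primitive minimal polynomial in Z[x]: clear the denominators of the
   monic minimal polynomial over Q, then divide by the content.  Since
   zprimitive normalizes the sign, its leading coefficient is positive. *)
Definition minZpoly (a : algC) : {poly int} :=
  zprimitive (projT1 (rat_poly_scale (minQpoly a))).

Lemma minZpolyP (a : algC) :
  [/\ root (map_poly intr (minZpoly a)) a,
      size (minZpoly a) = size (minCpoly a),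
      zcontents (minZpoly a) = 1
    & 0 < lead_coef (minZpoly a)].
Proof.
rewrite /minZpoly /minQpoly; case: minCpolyP => p /= [ep pm] _.
case: rat_poly_scale => q [c c0 e] /=.
have q0 : q != 0.
  apply/eqP => q0; move: pm; rewrite e q0 rmorph0 scaler0 monicE lead_coef0 => /eqP H.
  by have := oner_neq0 rat; rewrite -H eqxx.
have Q : map_poly (intr : int -> algC) q = c%:~R *: minCpoly a.
  rewrite ep e map_polyZ fmorphV rmorph_int scalerA mulfV ?intr_eq0 // scale1r.
  by rewrite -map_poly_comp; apply: eq_map_poly => x; rewrite /= -[RHS]/(ratr _) ratr_int.
split.
- have := root_minCpoly a; rewrite -(@rootZ _ a c%:~R) ?intr_eq0 // -Q {1}(zpolyEprim q).
  rewrite linearZ /= rootZ // intr_eq0 zcontents_eq0 //.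
- rewrite size_zprimitive -(size_map_inj_poly (f:=intr : int -> algC) (intr_inj)) // Q size_scale // intr_eq0 //.
- by rewrite zcontents_primitive q0.
- by rewrite -sgz_gt0 sgz_lead_primitive q0.
Qed.

Definition complex_roots (f : {poly int}) : seq algC :=
  sval (closed_field_poly_normal (map_poly intr f)).

(* Num.max is taken in the partial order of algC, but both of its arguments
   are real here. *)
Definition mahler (a : algC) : algC :=
  `|(lead_coef (minZpoly a))%:~R| *
    \prod_(z <- complex_roots (minZpoly a)) Num.max 1 `|z|.

Definition preperiodic (a : algC) : Prop :=
  exists s : seq algC, forall n : nat, iter n mahler a \in s.

Definition wandering (a : algC) : Prop := ~ preperiodic a.

(* rho lists the real embeddings, and tau lists one embedding from each pair
   of complex conjugate embeddings. *)
Definition has_signature (F : fieldExtType rat) (r s : nat) : Prop :=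
  exists (rho : 'I_r -> {rmorphism F -> algC})
         (tau : 'I_s -> {rmorphism F -> algC}),
    [/\ forall i x, rho i x \is Num.real,
        forall j, exists x, tau j x \isn't Num.real,
        forall i i', rho i =1 rho i' -> i = i',
        forall j j', tau j =1 tau j' \/ tau j =1 (fun x => (tau j' x)^*) ->
          j = j'
      & forall phi : {rmorphism F -> algC},
          (exists i, phi =1 rho i) \/
          (exists j, phi =1 tau j \/ phi =1 (fun x => (tau j x)^*))].

(* E is the smallest Galois extension of Q containing K. *)
Definition is_galois_closure (L : splittingFieldType rat)
    (K E : {subfield L}) : Prop :=
  [/\ (K <= E)%VS, galois 1 E
    & forall F : {subfield L}, (K <= F)%VS -> galois 1 F -> (E <= F)%VS].

Lemma galois_closure_exists (L : splittingFieldType rat) (K : {subfield L}) :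
  exists E : {subfield L}, is_galois_closure K E.
Proof.
have char0L : [pchar L] =i pred0.
  by move=> p; rewrite (pchar_lalg L) pchar_num.
have galL (F : {subfield L}) : galois F {:L}.
  rewrite /galois subvf normalFieldf andbT.
  by apply/separableP => x _; apply: pcharf0_separable.
pose H := (gcore 'Gal({:L} / K) 'Gal({:L} / 1%AS))%g.
have fixK (F : {subfield L}) : fixedField 'Gal({:L} / F)%g = F.
  exact/galois_fixedField.
exists (fixedField H)%AS; split.
- by rewrite -{1}(fixK K); apply/fixedFieldS/gcore_sub.
- apply: normal_fixedField_galois (galL 1%AS) _ _.
  by apply: gcore_normal; apply: galS; apply: sub1v.
move=> F sKF /and3P[sF1 _ nF1]; rewrite -[F in (_ <= F)%VS]fixK.
apply: fixedFieldS; apply: gcore_max; first exact: galS.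
have sF : (1 <= F <= {:L})%VS by rewrite sF1 subvf.
by have /andP[] := normalField_normal sF nF1.
Qed.

(* The inverse is given explicitly: the condition a^-1 \in Aint would also
   hold for a = 0, because 0^-1 = 0. *)
Definition alg_unit (L : splittingFieldType rat)
    (iota : {rmorphism L -> algC}) (K : {subfield L}) (a : L) : Prop :=
  [/\ a \in K, iota a \in Aint
    & exists b, [/\ b \in K, iota b \in Aint & a * b = 1]].

(* Main.v *)
Require Import Defs.
From HB Require Import structures.
From mathcomp Require Import all_boot all_order all_algebra.
From mathcomp Require Import all_fingroup all_solvable all_field.
From mathcomp Require Import ring.

Set Implicit Arguments.
Unset Strict Implicit.
Unset Printing Implicit Defensive.

Import Order.TTheory GRing.Theory Num.Theory.

(** Let h_0, h_1 (real) and h_2, h_3 (complex conjugate) be the embeddings of K,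
    realized by elements of G = Gal(E/Q); G permutes them faithfully and
    transitively, and complex conjugation is the transposition (2 3).  A
    transitive subgroup of S_4 containing (2 3) is either S_4, or it preserves
    the partition 01|23 and is then dihedral of order 8 (S4_or_D8).  The two
    groups are told apart by the behaviour of the Mahler measure.

    For x in the Galois field E, M(x) is |a| times the product of max(1, |y|)
    over the G-orbit of x, where a is the leading coefficient of the primitive
    minimal polynomial (mahler_conjs).  Numbers with at most two conjugates are
    always preperiodic (deg_le2_preperiodic).

    Dihedral case.  Write x_i for h_i x, with x in K of degree 4.  As 01 and 23
    are blocks, x_0 x_1 and x_2 x_3 have at most two conjugates.  Since
    |x_2| = |x_3|, the value M(x) is then a rational integer, or a number with at
    most two conjugates, or |a x_i|, or |n / x_i| for a real place i, where n is
    the constant coefficient (mahler_step).  In the last two cases M(x) is up to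
    sign a conjugate of an algebraic integer of K, so assume that x is one.  Then
    |x_i| is fixed by M, and two consecutive steps of the kind x |-> n / x
    multiply x by n^2.  If |n| = 1 the orbit is periodic; if |n| > 1, both real
    conjugates eventually exceed 1 in absolute value, and the last two cases
    cannot occur any more (preperiodic_of_growth).

    Symmetric case.  Suppose that a unit v of K satisfies |v_0| > |v_1| > 1.
    Then M(v) = |v_0 v_1|, which has the six conjugates v_i v_j because G acts
    transitively on pairs; those outside the unit disc are v_0 v_1, v_0 v_2,
    v_0 v_3, with product v_0^2 (v_0 v_1 v_2 v_3) = v_0^2 up to sign.  So M^2
    squares v_0 in absolute value, and v is wandering (expanding_wandering).

    It remains to find a unit with both real conjugates outside [-1, 1]
    (unit_exists), a weak form of the unit theorem of Dirichlet.  A pigeonhole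
    argument gives algebraic integers of K with arbitrarily small real
    conjugates and bounded norm; two of them that are congruent modulo a common
    multiple of the possible norms have a unit as quotient. *)

(** * Transitive subgroups of S_4 containing a transposition *)

Notation i0 := (0%R : 'I_4).
Notation i1 := (1%R : 'I_4).
Notation i2 := (2%:R%R : 'I_4).
Notation i3 := (3%:R%R : 'I_4).

Lemma I4_ind (P : 'I_4 -> Prop) : P i0 -> P i1 -> P i2 -> P i3 -> forall i, P i.
Proof.
move=> P0 P1 P2 P3 [m lt_m].
by case: m lt_m => [|[|[|[|m]]]] // lt_m;
  [move: P0 | move: P1 | move: P2 | move: P3]; congr P; apply: val_inj.
Qed.

Definition real_index (i : 'I_4) : bool := (i < 2)%N.

Section DihedralQuartic.
Local Open Scope group_scope.

Lemma card_D8 : #|'D_8| = 8%N. Proof. exact: (@card_dihedral 4). Qed.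

(** The relations make the group a quotient of D_8, and the cyclic subgroup of
    order 4 is proper because x and y do not commute; so the order is 8. *)
Lemma involutions_isog_D8 (gT : finGroupType) (x y : gT) :
  #[x] = 2%N -> #[y] = 2%N -> #[x * y] = 4%N -> x * y != y * x ->
  <<[set x; y]>> \isog 'D_8.
Proof.
move=> ox oy oxy ncom.
have homG : <<[set x; y]>> \homg 'D_8.
  rewrite (@Grp'_dihedral 4) //; apply/existsP; exists (x, y); rewrite /= !xpair_eqE.
  have xy4 : (x * y) ^+ 4 = 1 by rewrite -oxy expg_order.
  by rewrite joing_idl joing_idr xy4 -{1}ox -oy !expg_order !eqxx.
have sxy : <[x * y]> \subset <<[set x; y]>>.
  by rewrite cycle_subG groupM ?mem_gen ?set21 ?set22.
have c8 : #|<<[set x; y]>>| = 8%N.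
  have := card_homg homG; have := cardSg sxy; rewrite card_D8.
  rewrite -orderE oxy; set n := #|_| => d4 d8.
  have {d4 d8} /orP[/eqP n4|/eqP//] : (n == 4)%N || (n == 8)%N.
    move: d4 d8; case/dvdnP=> k ->; rewrite (_ : 8 = 2 * 4)%N // dvdn_pmul2r //.
    by case: k => [|[|[|k]]] // /dvdn_leq.
  have exy : <<[set x; y]>> = <[x * y]>.
    by apply/esym/eqP; rewrite eqEcard sxy -orderE oxy -/n n4.
  have /centsP cc := cycle_abelian (x * y).
  have := cc x _ y _; rewrite -exy !mem_gen ?set21 ?set22 // => /(_ isT isT).
  by move/eqP; rewrite (negbTE ncom).
have := involutions_gen_dihedral ox oy; rewrite /= c8; apply.
by apply: contraNneq ncom => ->.
Qed.

Section TransitiveWithTransposition.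
Variable A : {group 'S_4}.
Hypothesis Atr : forall i j, exists2 s, s \in A & s i = j.
Hypothesis At : tperm i2 i3 \in A.

Lemma conj_tperm s i j : s \in A -> tperm i j \in A -> tperm (s i) (s j) \in A.
Proof. by move=> sA tA; rewrite -tpermJ groupJ. Qed.

(** Being linked by a transposition of A is thus an equivalence relation, whose
    classes are blocks for A by conj_tperm. *)
Lemma tperm_trans i j k : tperm i j \in A -> tperm j k \in A -> tperm i k \in A.
Proof.
have [-> //|nij] := eqVneq i j; have [->|nik] := eqVneq i k.
  by rewrite tperm1 group1.
move=> Hij Hjk; have := conj_tperm Hjk Hij.
by rewrite tpermL (@tpermD _ j k i) // eq_sym.
Qed.

Lemma full_of_tperms : (forall y, tperm i2 y \in A) -> A = [set: 'S_4] :> {set _}.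
Proof.
move=> h; apply/eqP; rewrite eqEsubset subsetT -(gen_tperm i2) gen_subG.
by apply/subsetP=> _ /imsetP[y _ ->].
Qed.

(** A conjugate of (2 3) that meets both halves joins an index i of the low half
    to {2, 3}.  The remaining index k is the image of 2 under some element of A,
    so a conjugate of (2 3) links k to the other three. *)
Lemma full_of_nonblock s :
  s \in A -> real_index (s i2) != real_index (s i3) -> A = [set: 'S_4] :> {set _}.
Proof.
move=> sA ne; apply: full_of_tperms.
have [i [ri ti]] : exists i, real_index i /\ tperm i2 i \in A.
  have := conj_tperm sA At; move: ne; move: (s i2) (s i3).
  have t2 j : ~~ real_index j -> tperm i2 j \in A.
    by elim/I4_ind: j => // _; rewrite tperm1 group1.
  move=> a b; case ra: (real_index a); case rb: (real_index b) => // _ tab.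
    exists a; split=> //; apply: tperm_trans (t2 b _) _; first by rewrite rb.
    by rewrite tpermC.
  by exists b; split=> //; apply: tperm_trans (t2 a _) tab; rewrite ra.
(* Only the link from 2 to one last index k remains to be found. *)
have key k : (forall m, m != k -> tperm i2 m \in A) -> forall y, tperm i2 y \in A.
  move=> h y; have [->{y}|] := eqVneq y k; last exact: h.
  have [u uA uk] := Atr i2 k; have := conj_tperm uA At; rewrite uk.
  rewrite tpermC; apply: tperm_trans; apply: h.
  by rewrite -uk (inj_eq perm_inj).
elim/I4_ind: i ri ti => // _ ti; [apply: (key i1) | apply: (key i0)] => m;
  by elim/I4_ind: m => // _; rewrite ?tperm1 ?group1.
Qed.

(** A contains both (0 1) and the involution y exchanging the two blocks; with
    x = (2 3) the product x y has order 4, so A has a dihedral subgroup of order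
    8.  This is all of A, because the order of A divides 24 and A is not S_4. *)
Lemma D8_of_blocks :
  {in A, forall s : 'S_4, real_index (s i2) = real_index (s i3)} -> A \isog 'D_8.
Proof.
move=> Ab.
have t01 : tperm i0 i1 \in A.
  have [s sA s2] := Atr i2 i0; have := conj_tperm sA At.
  have := Ab _ sA; have : s i2 != s i3 by rewrite (inj_eq perm_inj).
  by rewrite s2; elim/I4_ind: (s i3).
set x := tperm i2 i3; set y := tperm i0 i2 * tperm i1 i3.
(* An element s with s 0 = 2 maps the low block onto the high one: it is either
   y or y up to the transposition (0 1). *)
have yA : y \in A.
  have [s sA s0] := Atr i0 i2.
  have s1 : s i1 = i3.
    have e1 : s i1 != i2 by rewrite -[X in _ != X]s0 (inj_eq perm_inj).
    have := Ab _ sA.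
    have n2 : s i2 != i2 by rewrite -[X in _ != X]s0 (inj_eq perm_inj).
    have n3 : s i3 != i2 by rewrite -[X in _ != X]s0 (inj_eq perm_inj).
    have n23 : s i2 != s i3 by rewrite (inj_eq perm_inj).
    have n12 : s i1 != s i2 by rewrite (inj_eq perm_inj).
    have n13 : s i1 != s i3 by rewrite (inj_eq perm_inj).
    move: e1 n2 n3 n23 n12 n13.
    by elim/I4_ind: (s i1); elim/I4_ind: (s i2); elim/I4_ind: (s i3).
  have n20 : s i2 != i2 by rewrite -[X in _ != X]s0 (inj_eq perm_inj).
  have n21 : s i2 != i3 by rewrite -[X in _ != X]s1 (inj_eq perm_inj).
  have n30 : s i3 != i2 by rewrite -[X in _ != X]s0 (inj_eq perm_inj).
  have n31 : s i3 != i3 by rewrite -[X in _ != X]s1 (inj_eq perm_inj).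
  have n23 : s i2 != s i3 by rewrite (inj_eq perm_inj).
  have [s2|s2] : s i2 = i0 \/ s i2 = i1.
    by move: n20 n21; elim/I4_ind: (s i2); auto.
  - have s3 : s i3 = i1 by move: n23 n30 n31; rewrite s2; elim/I4_ind: (s i3).
    suff -> : y = s by [].
    apply/permP; elim/I4_ind; rewrite permM ?s0 ?s1 ?s2 ?s3.
    + by rewrite tpermL tpermD.
    + by rewrite (@tpermD _ i0 i2) // tpermL.
    + by rewrite tpermR tpermD.
    + by rewrite (@tpermD _ i0 i2) // tpermR.
  - have s3 : s i3 = i0 by move: n23 n30 n31; rewrite s2; elim/I4_ind: (s i3).
    suff -> : y = s * tperm i0 i1 by rewrite groupM.
    apply/permP; elim/I4_ind; rewrite !permM ?s0 ?s1 ?s2 ?s3.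
    + by rewrite !tpermL !tpermD.
    + by rewrite (@tpermD _ i0 i2) // tpermL tpermD.
    + by rewrite !tpermR tpermD.
    + by rewrite (@tpermD _ i0 i2) // tpermL tpermR.
have y0 : y i0 = i2 by rewrite permM tpermL tpermD.
have y1 : y i1 = i3 by rewrite permM (@tpermD _ i0 i2) // tpermL.
have y2 : y i2 = i0 by rewrite permM tpermR tpermD.
have y3 : y i3 = i1 by rewrite permM (@tpermD _ i0 i2) // tpermR.
have x0 : x i0 = i0 by rewrite tpermD.
have x1 : x i1 = i1 by rewrite tpermD.
have x2 : x i2 = i3 by rewrite tpermL.
have x3 : x i3 = i2 by rewrite tpermR.
have ord2 (z : 'S_4) : z != 1 -> z * z = 1 -> #[z] = 2%N.
  by move=> z1 zz; apply: nt_prime_order; rewrite // expgS expg1.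
have ox : #[x] = 2%N.
  apply: ord2; last exact: tperm2.
  by apply/eqP=> /permP/(_ i2); rewrite x2 perm1.
have oy : #[y] = 2%N.
  apply: ord2; first by apply/eqP=> /permP/(_ i2); rewrite y2 perm1.
  by apply/permP; elim/I4_ind; rewrite permM perm1 ?y0 ?y1 ?y2 ?y3 ?y0 ?y1.
have xA : x \in A := At.
clearbody x y; have oxy : #[x * y] = 4%N.
  have xy2 : (x * y) ^+ 2 != 1.
    apply/eqP=> /permP/(_ i0).
    by rewrite expgS expg1 perm1 !permM x0 y0 x2 y3.
  have xy4 : (x * y) ^+ 4 = 1.
    rewrite !expgS expg0; apply/permP; elim/I4_ind; rewrite !permM !perm1;
    by do 4 (rewrite ?x0 ?x1 ?x2 ?x3; rewrite ?y0 ?y1 ?y2 ?y3).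
  move/eqP: xy4; move: xy2; rewrite -!order_dvdn.
  have := order_gt0 (x * y); move: #[x * y] => n.
  by case: n => [|[|[|[|[|n]]]]] // _ _ /dvdn_leq/(_ isT).
have iso : <<[set x; y]>> \isog 'D_8.
  apply: involutions_isog_D8 => //.
  by apply/eqP=> /permP/(_ i0); rewrite !permM x0 y0 x2.
have c8 : #|<<[set x; y]>>| = 8%N by rewrite (card_isog iso) card_D8.
suff -> : A = <<[set x; y]>>%G :> {set _} by [].
have sub : <<[set x; y]>> \subset A.
  by rewrite gen_subG; apply/subsetP=> z /set2P[]->.
have dA := cardSg sub; rewrite c8 in dA.
have cS : #|[set: 'S_4]| = 24 by rewrite cardsT card_Sn.
have dS := cardSg (subsetT A); rewrite cS in dS.
(* The transposition (1 2) breaks the blocks. *)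
have nS : #|A| != 24.
  apply/eqP=> cA; have eA : A = [set: 'S_4]%G.
    by apply/val_inj/eqP; rewrite eqEcard subsetT /= cS cA.
  have := Ab (tperm i1 i2); rewrite eA inE => /(_ isT).
  by rewrite tpermR tpermD.
apply/eqP; rewrite eq_sym eqEcard sub c8.
move: dA dS nS; case/dvdnP=> k ->; rewrite (_ : 24 = 3 * 8)%N // dvdn_pmul2r //.
by case: k => [|[|[|[|k]]]] // /dvdn_leq; rewrite ?gtnNdvd.
Qed.

Lemma S4_or_D8 :
  A = [set: 'S_4] :> {set _} \/
  {in A, forall s : 'S_4, real_index (s i2) = real_index (s i3)} /\ A \isog 'D_8.
Proof.
have [Ab|/forall_inPn[s sA ns]] :=
    boolP [forall s in A, real_index (s i2) == real_index (s i3)].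
  right; have Ab' : {in A, forall s : 'S_4, real_index (s i2) = real_index (s i3)}.
    by move=> s sA; move/forall_inP: Ab => /(_ s sA)/eqP.
  by split=> //; apply: D8_of_blocks.
by left; apply: full_of_nonblock sA ns.
Qed.

End TransitiveWithTransposition.
End DihedralQuartic.

Local Open Scope ring_scope.

(** * Mahler measure as a product over a Galois orbit *)

(** Both sides vanish at x and have the same degree, and minCpoly x divides
    every rational polynomial vanishing at x. *)
Lemma minZpoly_eq (x : algC) :
  map_poly intr (minZpoly x) = (lead_coef (minZpoly x))%:~R *: minCpoly x.
Proof.
have [rx sz _ _] := minZpolyP x.
pose f : {poly rat} := map_poly intr (minZpoly x).
have ef : map_poly intr (minZpoly x) = map_poly ratr f :> {poly algC}.
  by apply/polyP=> i; rewrite !coef_map /= ratr_int.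
have szf : size f = size (minCpoly x).
  by rewrite -sz size_map_inj_poly //; exact: intr_inj.
have [p [ep pm] dp] := minCpolyP x.
have : p %| f by rewrite -dp -ef.
have szp : size p = size (minCpoly x) by rewrite ep size_map_poly.
case/dvdpP=> q eq; have f0 : f != 0.
  by rewrite -size_poly_gt0 szf size_poly_gt0 minCpoly_eq0.
have [q0 p0] : q != 0 /\ p != 0 by move: f0; rewrite eq mulf_eq0 negb_or => /andP.
have sq : size q = 1%N.
  have := szf; rewrite eq size_mul // szp -szp.
  have := size_poly_gt0 p; rewrite p0; case: (size p) => // n _.
  by rewrite addnS /= => /(canRL (addnK _)); rewrite subSnn.
have /size_poly1P[c c0 ec] : size q == 1%N by rewrite sq.
have lc : lead_coef f = c.
  by rewrite eq ec mul_polyC lead_coefZ (monicP pm) mulr1.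
have lf : lead_coef f = (lead_coef (minZpoly x))%:~R.
  by rewrite lead_coef_map_inj //; exact: intr_inj.
rewrite ef eq ec mul_polyC ep map_polyZ -lc lf /=; congr (_ *: _).
by rewrite ratr_int.
Qed.

(** For an algebraic integer, minZpoly x is an integer multiple of a monic
    integer polynomial; being primitive, it is that polynomial. *)
Lemma lead_minZpoly_Aint (x : algC) : x \in Aint -> lead_coef (minZpoly x) = 1.
Proof.
move=> xA; have [_ _ c1 l0] := minZpolyP x.
have /floorpP[g eg] : minCpoly x \is a polyOver Num.int by [].
have gm : g \is monic.
  have := minCpoly_monic x; rewrite eg !monicE lead_coef_map_inj //; last exact: intr_inj.
  by rewrite -[1]/(1%:~R) eqr_int.
have e : minZpoly x = lead_coef (minZpoly x) *: g.
  apply: (map_inj_poly (f := intr : int -> algC)) => //; first exact: intr_inj.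
  by rewrite minZpoly_eq map_polyZ -eg.
by have := zcontentsZ (lead_coef (minZpoly x)) g; rewrite -e c1 zcontents_monic // mulr1.
Qed.

(** With a the leading coefficient and d the degree, a x is a root of the monic
    polynomial a^(d-1) f(X / a), whose coefficients are integers. *)
Lemma Aint_lead_mul (f : {poly int}) (x : algC) :
  root (map_poly intr f) x -> (lead_coef f)%:~R * x \in Aint.
Proof.
have [->|f0] := eqVneq f 0; first by rewrite lead_coef0 mul0r rpred0.
move=> rfx; set a := lead_coef f.
have [d sf] : exists d, size f = d.+1.
  by exists (size f).-1; rewrite prednK ?size_poly_gt0.
case: d sf => [|d] sf.
  move: rfx; rewrite (size1_polyC (_ : size f <= 1)%N) ?sf // map_polyC rootC.
  by rewrite intr_eq0 -[f`_0]/(f`_(1.-1)) -sf -lead_coefE lead_coef_eq0 (negbTE f0).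
pose g : {poly int} := 'X^(d.+1) + \poly_(i < d.+1) (f`_i * a ^+ (d - i)).
have gm : g \is monic.
  by rewrite monicE lead_coefDl ?lead_coefXn // size_polyXn ltnS size_poly.
apply: (@root_monic_Aint (map_poly intr g)).
- rewrite rootE /g rmorphD /= map_polyXn hornerD hornerXn.
  have -> : map_poly intr (\poly_(i < d.+1) (f`_i * a ^+ (d - i)))
       = \poly_(i < d.+1) ((f`_i)%:~R * a%:~R ^+ (d - i)) :> {poly algC}.
    apply/polyP=> i; rewrite coef_map !coef_poly; case: ifP => _ /=; rewrite ?rmorph0 //.
    by rewrite rmorphM rmorphXn.
  have e : \sum_(i < d.+1) (f`_i)%:~R * x ^+ i + a%:~R * x ^+ d.+1 = 0.
    have /eqP := rfx; rewrite horner_coef size_map_inj_poly //; last exact: intr_inj.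
    rewrite sf big_ord_recr /= => {2}<-; rewrite coef_map /= /a lead_coefE sf.
    by congr (_ + _); apply: eq_bigr => i _; rewrite coef_map.
  rewrite horner_poly -[X in _ == X](mulr0 (a%:~R ^+ d)) -[X in _ == _ * X]e; apply/eqP.
  rewrite mulrDr mulr_sumr addrC; congr (_ + _).
    apply: eq_bigr => i _; rewrite exprMn_comm; last exact: mulrC.
    have -> : a%:~R ^+ d = a%:~R ^+ (d - i) * a%:~R ^+ i :> algC.
      by rewrite -exprD subnK // -ltnS.
    by ring.
  by rewrite mulrA -exprSr exprMn_comm //; exact: mulrC.
- by rewrite monicE lead_coef_map_inj ?(monicP gm) //; exact: intr_inj.
- by apply/polyOverP=> i; rewrite coef_map /= intr_int.
Qed.

(** The inverse of x is a root of the reversed polynomial, which has the constant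
    coefficient of f as leading coefficient. *)
Lemma Aint_const_div (f : {poly int}) (x : algC) :
  root (map_poly intr f) x -> (f`_0)%:~R / x \in Aint.
Proof.
have [->|x0] := eqVneq x 0; first by rewrite invr0 mulr0 rpred0.
have [->|c0] := eqVneq f`_0 0; first by rewrite mul0r rpred0.
move=> rfx; have f0 : f != 0 by apply: contraNneq c0 => ->; rewrite coef0.
have [d sf] : exists d, size f = d.+1.
  by exists (size f).-1; rewrite prednK ?size_poly_gt0.
pose g : {poly int} := \poly_(i < d.+1) f`_(d - i).
have lg : lead_coef g = f`_0 by rewrite lead_coef_poly ?subnn.
rewrite -lg; apply: Aint_lead_mul; rewrite rootE; apply/eqP.
have -> : map_poly intr g = \poly_(i < d.+1) (f`_(d - i))%:~R :> {poly algC}.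
  by apply/polyP=> i; rewrite coef_map !coef_poly; case: ifP.
have /eqP := rfx; rewrite horner_coef size_map_inj_poly //; last exact: intr_inj.
rewrite sf => e; rewrite horner_poly -[RHS](mulr0 (x ^- d)) -[X in _ = _ * X]e.
rewrite mulr_sumr (reindex_inj rev_ord_inj) /=; apply: eq_bigr => i _.
rewrite coef_map /= subSS subKn -1?ltnS // mulrCA; congr (_ * _).
have -> : x ^- d = x ^- (d - i) * x ^- i by rewrite -invfM -exprD subnK // -ltnS.
by rewrite mulfVK ?expf_neq0 // exprVn.
Qed.

Lemma minQpolyE (x : algC) : map_poly ratr (minQpoly x) = minCpoly x.
Proof. by rewrite /minQpoly; case: minCpolyP => p /= [-> _]. Qed.

Section GaloisOrbits.
Variables (L : splittingFieldType rat) (phi : {rmorphism L -> algC}).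
Variables (E : {subfield L}) (galE : galois 1 E).

(** For x in E these are the conjugates of x over the rationals, without
    repetition. *)
Definition conjs (x : L) : seq L := undup [seq gal_repr g x | g : gal_of E].

Lemma conjsP x y : reflect (exists g : gal_of E, y = g x) (y \in conjs x).
Proof.
rewrite mem_undup; apply: (iffP imageP) => [[g _ ->]|[g ->]]; first by exists g.
by exists g.
Qed.

Lemma conjs_uniq x : uniq (conjs x).
Proof. exact: undup_uniq. Qed.

Lemma all_gal (g : gal_of E) : g \in 'Gal(E / 1%AS)%g.
Proof. by rewrite gal_kAut ?sub1v // kAut1E limg_gal. Qed.

Lemma minPoly_conjs x : x \in E ->
  minPoly 1 x = \prod_(y <- conjs x) ('X - y%:P).
Proof.
move=> xE; have /(galois_factors (sub1v E))/(_ x xE) := galE.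
case=> r [rG ur er]; rewrite er; apply: perm_big; apply: uniq_perm => //.
  exact: conjs_uniq.
move=> y; apply/mapP/conjsP=> [[g _ ->]|[g ->]]; first by exists g.
have := root_minPoly_gal (sub1v E) (all_gal g) xE.
by rewrite er root_prod_XsubC => /mapP.
Qed.

(** Links the minimal polynomial inside the abstract field L with the one of the
    image in the complex numbers, so that Galois theory applies to the latter. *)
Lemma map_minPoly_phi x : map_poly phi (minPoly 1 x) = minCpoly (phi x).
Proof.
have /polyOver1P[q eq] := minPolyOver 1%VS x.
have mq : map_poly phi (minPoly 1 x) = map_poly ratr q.
  rewrite eq; apply/polyP=> i; rewrite !coef_map /=.
  by rewrite rmorphZ_num rmorph1 mulr1.
have [p [ep pm] dp] := minCpolyP (phi x); rewrite mq ep.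
have qm : q \is monic.
  by have := monic_minPoly 1%VS x; rewrite eq map_monic.
suff -> : q = p by [].
apply/eqP; rewrite -eqp_monic // /eqp; apply/andP; split; last first.
  by rewrite -dp -mq fmorph_root root_minPoly.
have : minPoly 1 x %| map_poly (in_alg L) p.
  apply: minPoly_dvdp; first by apply/polyOver1P; exists p.
  rewrite -(fmorph_root phi).
  have -> : map_poly phi (map_poly (in_alg L) p) = map_poly ratr p.
    apply/polyP=> i; rewrite !coef_map /=.
    by rewrite rmorphZ_num rmorph1 mulr1.
  by rewrite dp.
by rewrite eq dvdp_map.
Qed.

Lemma minCpoly_conjs x : x \in E ->
  minCpoly (phi x) = \prod_(y <- conjs x) ('X - (phi y)%:P).
Proof.
move=> xE; rewrite -map_minPoly_phi minPoly_conjs // rmorph_prod /=.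
by apply: eq_bigr => y _; rewrite map_polyXsubC.
Qed.

Lemma conjs_gal x (g : gal_of E) : x \in E -> perm_eq (conjs (g x)) (conjs x).
Proof.
move=> xE; apply: uniq_perm; rewrite ?conjs_uniq // => y.
apply/conjsP/conjsP=> -[h ->]; first by exists (g * h)%g; rewrite galM.
by exists (g^-1 * h)%g; rewrite galM ?memv_gal // -(galM g) // mulgV gal_id.
Qed.

Lemma minCpoly_gal x (g : gal_of E) : x \in E ->
  minCpoly (phi (g x)) = minCpoly (phi x).
Proof.
move=> xE; rewrite !minCpoly_conjs ?memv_gal //; apply: perm_big.
exact: conjs_gal.
Qed.

Lemma Aint_gal x (g : gal_of E) : x \in E ->
  (phi (g x) \in Aint) = (phi x \in Aint).
Proof. by move=> xE; rewrite !unfold_in minCpoly_gal. Qed.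

Lemma mahler_conjs x : x \in E ->
  mahler (phi x) = (lead_coef (minZpoly (phi x)))%:~R *
     \prod_(y <- conjs x) Num.max 1 `|phi y|.
Proof.
move=> xE; rewrite /mahler; set f := minZpoly _.
have [_ _ _ lf] := minZpolyP (phi x).
rewrite ger0_norm ?ler0z ?ltW // ; congr (_ * _).
rewrite /complex_roots; case: closed_field_poly_normal => r /=.
have lfC : lead_coef (map_poly intr f) = (lead_coef f)%:~R :> algC.
  by rewrite lead_coef_map_inj //; exact: intr_inj.
rewrite lfC minZpoly_eq -/f => /scalerI er.
have {er} /prod_XsubC_eq pr :
    \prod_(z <- r) ('X - z%:P) = \prod_(z <- map phi (conjs x)) ('X - z%:P).
  by rewrite -er ?intr_eq0 ?gt_eqF // big_map minCpoly_conjs.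
by rewrite (perm_big _ pr) big_map.
Qed.

(** The Mahler measure depends on the minimal polynomial only. *)
Lemma mahler_gal x (g : gal_of E) : x \in E ->
  mahler (phi (g x)) = mahler (phi x).
Proof.
move=> xE; have e : minQpoly (phi (g x)) = minQpoly (phi x).
  apply: (map_poly_inj (ratr : {rmorphism rat -> algC})).
  by rewrite /= !minQpolyE minCpoly_gal.
by rewrite /mahler /minZpoly e.
Qed.

Lemma mahler_Aint x s : x \in E -> phi x \in Aint -> uniq s -> s =i conjs x ->
  mahler (phi x) = \prod_(y <- s) Num.max 1 `|phi y|.
Proof.
move=> xE xA us es; rewrite mahler_conjs // lead_minZpoly_Aint // mul1r.
by apply: perm_big; rewrite perm_sym; apply: uniq_perm => //; apply: conjs_uniq.
Qed.

Lemma conjsZ x c : c != 0 -> x \in E ->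
  perm_eq (conjs (c *: x)) (map (GRing.scale c) (conjs x)).
Proof.
move=> c0 xE; apply: uniq_perm; rewrite ?conjs_uniq ?map_inj_uniq ?conjs_uniq //.
  exact: scalerI.
move=> y; apply/conjsP/mapP => [[g ->]|[z /conjsP[g ->] ->]].
  by exists (g x); rewrite ?linearZ //; apply/conjsP; exists g.
by exists g; rewrite linearZ.
Qed.

Lemma size_conjs x : x \in E -> (size (conjs x)).+1 = size (minPoly 1 x).
Proof. by move=> xE; rewrite minPoly_conjs // size_prod_XsubC. Qed.

Lemma const_minZpoly x : x \in E ->
  ((minZpoly (phi x))`_0)%:~R = (lead_coef (minZpoly (phi x)))%:~R *
     \prod_(y <- conjs x) - phi y :> algC.
Proof.
move=> xE; have := congr1 (fun p : {poly algC} => p.[0]) (minZpoly_eq (phi x)).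
rewrite /= horner_coef0 coef_map /= => ->; rewrite hornerZ minCpoly_conjs //.
rewrite horner_prod; congr (_ * _); apply: eq_bigr => y _.
by rewrite hornerXsubC sub0r.
Qed.

End GaloisOrbits.

(** * Numbers with at most two conjugates *)

Lemma preperiodic_mahler x : preperiodic (mahler x) -> preperiodic x.
Proof.
case=> s hs; exists (x :: s) => -[|n]; first by rewrite inE eqxx.
by rewrite iterSr inE hs orbT.
Qed.

Lemma periodic_preperiodic p x : iter p.+1 mahler x = x -> preperiodic x.
Proof.
move=> e; exists [seq iter i mahler x | i <- iota 0 p.+1] => n.
apply/mapP; exists (n %% p.+1)%N; first by rewrite mem_iota /= add0n ltn_mod.
have eM k : iter (k * p.+1) mahler x = x.
  by elim: k => // k IH; rewrite mulSn iterD IH.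
by rewrite {1}(divn_eq n p.+1) addnC iterD eM.
Qed.

Variant max1_spec (x : algC) : algC -> Type :=
  | Max1Le of `|x| <= 1 : max1_spec x 1
  | Max1Gt of 1 < `|x| : max1_spec x `|x|.

Lemma max1P x : max1_spec x (Num.max 1 `|x|).
Proof.
have [le|lt] := real_leP (normr_real x) (real1 _).
  exact: Max1Le.
exact: Max1Gt.
Qed.

Lemma mulr_ge1_gt1 (a x : algC) : 1 <= a -> 1 < x -> 1 < a * x.
Proof.
move=> a1 x1; apply: (lt_le_trans x1).
by rewrite ler_peMl // (le_trans ler01 (ltW x1)).
Qed.

Section AtMostQuadratic.
Variables (L : splittingFieldType rat) (phi : {rmorphism L -> algC}).
Variables (E : {subfield L}) (galE : galois 1 E).
Local Notation conjs := (conjs E).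

Definition deg_le2 x := (size (conjs x) <= 2)%N.

Lemma mem_conjs x : x \in conjs x.
Proof. by apply/conjsP; exists 1%g; rewrite gal_id. Qed.

Lemma phiZ (c : rat) x : phi (c *: x) = ratr c * phi x.
Proof. exact: rmorphZ_num. Qed.

Lemma norm_phi_real x : phi x \is Num.real ->
  exists2 c : rat, c = 1 \/ c = -1 & `|phi x| = phi (c *: x).
Proof.
move=> xr; have [x0|x0] := real_ge0P xr.
  by exists 1; [left | rewrite scale1r].
by exists (-1); [right | rewrite scaleN1r rmorphN].
Qed.

Lemma mahler_nat (m : nat) : mahler m%:R = (maxn 1 m)%:R.
Proof.
have e : phi (m%:R) = m%:R by rewrite rmorph_nat.
have mE : m%:R \in E by rewrite rpred_nat.
have cm : [:: m%:R] =i conjs (m%:R : L).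
  move=> y; rewrite inE; apply/eqP/conjsP => [->|[g ->]]; first by exists 1%g; rewrite gal_id.
  by rewrite rmorph_nat.
rewrite -e (@mahler_Aint _ phi _ galE _ _ mE _ _ cm) ?e ?rpred_nat //.
rewrite big_seq1 e normr_nat.
have [le|lt] := leqP 1 m; first by rewrite max_r // ler1n.
by rewrite max_l // -[1]/(1%:R) ler_nat ltnW.
Qed.

Lemma preperiodic_nat (m : nat) : preperiodic m%:R.
Proof.
apply: preperiodic_mahler; apply: (@periodic_preperiodic 0).
by rewrite /= !mahler_nat maxnA maxnn.
Qed.

Lemma preperiodic_norm_int (n : int) : preperiodic `|n%:~R|.
Proof. by rewrite -intr_norm -abszE; apply: preperiodic_nat. Qed.

Lemma lead_minZpoly_ge1 x : 1 <= (lead_coef (minZpoly x))%:~R :> algC.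
Proof.
have [_ _ _] := minZpolyP x.
by rewrite -[1 in X in _ -> X]/(1%:~R) ler_int gtz0_ge1.
Qed.

Lemma root_minZpoly_conjs x y : x \in E -> y \in conjs x ->
  root (map_poly intr (minZpoly (phi x))) (phi y).
Proof.
move=> xE yx; rewrite minZpoly_eq rootZ; last first.
  by rewrite intr_eq0 lead_coef_eq0; have [_ _ _ ] := minZpolyP (phi x);
     apply: contraTneq => ->; rewrite lead_coef0.
rewrite (minCpoly_conjs phi galE) // -(big_map phi predT (fun z => 'X - z%:P)) root_prod_XsubC.
exact: map_f.
Qed.

Lemma conjC_conjs x : x \in E -> (phi x)^* \in map phi (conjs x).
Proof.
move=> xE; rewrite -root_prod_XsubC big_map -(minCpoly_conjs phi galE) //.
rewrite -(minCpoly_aut (Num.conj : {rmorphism algC -> algC})).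
exact: root_minCpoly.
Qed.

(** M(x) is a rational integer unless x has two conjugates u, v with
    |v| <= 1 < |u|.  Then u is real, since its complex conjugate cannot be v, and
    M(x) = |a u| is an algebraic integer w whose other conjugate is a v up to
    sign.  Either |a v| <= 1 and w is fixed, or M(w) = |a u a v| is a rational
    integer. *)
Lemma deg_le2_preperiodic x : x \in E -> deg_le2 x -> preperiodic (phi x).
Proof.
move=> xE; rewrite /deg_le2 => sx.
pose f := minZpoly (phi x); pose a := lead_coef f; pose n := f`_0.
have a1 : 1 <= a%:~R :> algC := lead_minZpoly_ge1 _.
have a0 : 0 < a%:~R :> algC := lt_le_trans ltr01 a1.
have aN : `|a%:~R| = a%:~R :> algC by rewrite gtr0_norm.
have key u v : perm_eq (conjs x) [:: u; v] -> 1 < `|phi u| -> `|phi v| <= 1 ->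
  preperiodic (phi x).
  move=> puv u1 v1.
  have ux : u \in conjs x by rewrite (perm_mem puv) mem_head.
  have /conjsP[g eu] := ux.
  have uE : u \in E by rewrite eu memv_gal.
  have pu : perm_eq (conjs u) [:: u; v] by apply: perm_trans puv; rewrite eu conjs_gal.
  have ur : phi u \is Num.real.
    have := conjC_conjs uE; rewrite (eq_mem_map _ (perm_mem pu)) /= !inE CrealE.
    case/orP=> // /eqP e; have := v1; rewrite -e norm_conjC => u1'.
    by have := lt_le_trans u1 u1'; rewrite ltxx.
  have [c c1 ec] := norm_phi_real ur.
  have c0 : c != 0 by case: c1 => ->.
  have cN : `|ratr c| = 1 :> algC by case: c1 => ->; rewrite ?rmorphN ?rmorph1 ?normrN normr1.
  have cI : ratr c \in Aint by case: c1 => ->; rewrite ?rmorphN rmorph1 ?rpredN rpred1.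
  (* The sign c makes w nonnegative, so that w is the value M(x) itself. *)
  pose w := (c * a%:~R) *: u.
  have wE : w \in E by rewrite memvZ.
  have ew : phi w = a%:~R * `|phi u|.
    by rewrite /w ec !phiZ rmorphM /= ratr_int; ring.
  have ca0 : c * a%:~R != 0.
    by rewrite mulf_neq0 // intr_eq0 -(intr_eq0 algC) gt_eqF.
  have wA : phi w \in Aint.
    rewrite /w phiZ rmorphM /= ratr_int -mulrA rpredM //.
    by apply: Aint_lead_mul; apply: root_minZpoly_conjs.
  have Mx : mahler (phi x) = phi w.
    rewrite (mahler_conjs phi galE) // (perm_big _ puv) /= big_cons big_seq1 -/f -/a ew.
    by rewrite (max_l v1) (max_r (ltW u1)) mulr1.
  have wu : `|phi ((c * a%:~R) *: u)| = a%:~R * `|phi u|.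
    by rewrite phiZ normrM rmorphM /= ratr_int normrM cN mul1r aN.
  have wv : `|phi ((c * a%:~R) *: v)| = a%:~R * `|phi v|.
    by rewrite phiZ normrM rmorphM /= ratr_int normrM cN mul1r aN.
  have pw : perm_eq (conjs w) [:: w; (c * a%:~R) *: v].
    apply: perm_trans (conjsZ ca0 uE) _.
    by apply: (perm_map (GRing.scale _) pu).
  have Mw : mahler (phi w) = Num.max 1 `|phi w| * Num.max 1 `|phi ((c * a%:~R) *: v)|.
    have pws : perm_eq [:: w; (c * a%:~R) *: v] (conjs w) by rewrite perm_sym.
    rewrite (mahler_Aint galE wE wA _ (perm_mem pws)) ?big_cons ?big_nil ?mulr1 //.
    by rewrite (perm_uniq pws) conjs_uniq.
  apply: preperiodic_mahler; rewrite Mx.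
  have w1 : 1 < `|phi w| by rewrite wu; apply: mulr_ge1_gt1.
  move: Mw; case: (max1P (phi w)) => [h|_]; first by have := lt_le_trans w1 h; rewrite ltxx.
  case: max1P => [_|v1'] Mw.
    apply: (@periodic_preperiodic 0); rewrite /= Mw mulr1 wu ew //.
  apply: preperiodic_mahler; rewrite Mw wu wv.
  have := const_minZpoly phi galE xE;
  rewrite (perm_big _ puv) /= big_cons big_seq1 -/f -/a -/n => en.
  have -> : a%:~R * `|phi u| * (a%:~R * `|phi v|) = `|(a * n)%:~R| :> algC.
    by rewrite intrM en !normrM !normrN aN; ring.
  exact: preperiodic_norm_int.
have en := const_minZpoly phi galE xE; rewrite -/f -/a -/n in en.
have Mx := mahler_conjs phi galE xE; rewrite -/f -/a in Mx.
have := mem_conjs x; move: sx key en Mx.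
case: (conjs x) (conjs_uniq E x) => [|u [|v [|w s]]] // _ _ key.
  rewrite !big_seq1 => en Mx _; apply: preperiodic_mahler; rewrite Mx.
  case: max1P => _; first by rewrite mulr1 -aN; apply: preperiodic_norm_int.
  have -> : a%:~R * `|phi u| = `|n%:~R| :> algC by rewrite en normrM normrN aN.
  exact: preperiodic_norm_int.
rewrite !big_cons !big_nil !mulr1 => en Mx _.
have [u1|u1] := real_leP (normr_real (phi u)) (real1 _);
have [v1|v1] := real_leP (normr_real (phi v)) (real1 _).
- apply: preperiodic_mahler; rewrite Mx !max_l // !mulr1 -aN.
  exact: preperiodic_norm_int.
- by apply: (key v u) => //; rewrite (perm_catC [:: u] [:: v]).
- by apply: (key u v).
- apply: preperiodic_mahler; rewrite Mx !max_r ?ltW //.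
  have -> : a%:~R * (`|phi u| * `|phi v|) = `|n%:~R| :> algC.
    by rewrite en !normrM !normrN aN.
  exact: preperiodic_norm_int.
Qed.

End AtMostQuadratic.

(** * The four embeddings and the Galois action on them *)

Section Embeddings.
Variables (L : splittingFieldType rat) (phi : {rmorphism L -> algC}).
Variables (K E : {subfield L}) (galE : galois 1 E) (sKE : (K <= E)%VS).
Local Notation conjs := (conjs E).

Lemma separable_rat (F : {subfield L}) : separable 1 F.
Proof.
apply/separableP => x _; apply: pcharf0_separable => p.
by rewrite (pchar_lalg L) pchar_num.
Qed.

(** The image of a primitive element t of F is a root of the minimal polynomial
    of t, hence comes from some g t, and t determines the embedding. *)
Lemma embedding_gal (F : {subfield L}) (f : {rmorphism subvs_of F -> algC}) :
  (F <= E)%VS ->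
  exists g : gal_of E, forall x, f x = phi (g (vsval x)).
Proof.
move=> sFE.
have eF := eq_adjoin_separable_generator (separable_rat F) (sub1v F).
have tF := separable_generator_mem F 1%AS.
set t := separable_generator _ _ in eF tF.
have tE : t \in E by apply: (subvP sFE).
have etF : vsval (vsproj F t) = t by apply: vsprojK.
have hrat (q : {poly rat}) (S : fieldExtType rat) (k : {rmorphism S -> algC}) y :
    k (map_poly (in_alg S) q).[y] = (map_poly ratr q).[k y].
  rewrite -horner_map /=; congr _.[_].
  by apply/polyP=> i; rewrite !coef_map /= rmorphZ_num rmorph1 mulr1.
have vrat (q : {poly rat}) y :
    vsval (map_poly (in_alg (subvs_of F)) q).[y] = (map_poly (in_alg L) q).[vsval y].
  rewrite -horner_map /=; congr _.[_].
  by apply/polyP=> i; rewrite !coef_map /= algid1.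
have /polyOver1P[q eq] := minPolyOver 1%VS t.
have ft0 : root (minCpoly (phi t)) (f (vsproj F t)).
  rewrite -map_minPoly_phi eq.
  have -> : map_poly phi (map_poly (in_alg L) q) = map_poly ratr q.
    by apply/polyP=> i; rewrite !coef_map /= rmorphZ_num rmorph1 mulr1.
  rewrite rootE -hrat; apply/eqP; rewrite -[RHS](rmorph0 f); congr (f _).
  apply/val_inj; rewrite /= vrat etF -eq minPolyxx //.
move: ft0; rewrite (minCpoly_conjs phi galE) // -(big_map phi predT (fun z => 'X - z%:P)).
rewrite root_prod_XsubC => /mapP[_ /conjsP[g ->] eg]; exists g => x.
have : vsval x \in <<1; t>>%VS by rewrite -eF subvsP.
case/Fadjoin_polyP => p /polyOver1P[r ->] ex.
have -> : x = (map_poly (in_alg (subvs_of F)) r).[vsproj F t].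
  by apply/val_inj; rewrite /= ex vrat etF.
rewrite vrat hrat eg etF.
pose pg : {rmorphism L -> algC} := phi \o (gal_repr g : {rmorphism L -> L}).
by rewrite -(hrat _ _ pg).
Qed.

Lemma conjC_gal : exists c : gal_of E, {in E, forall x, phi (c x) = (phi x)^*}.
Proof.
pose f : {rmorphism subvs_of E -> algC} :=
  (Num.conj : {rmorphism algC -> algC}) \o phi \o (vsval : {rmorphism subvs_of E -> L}).
have [c hc] := embedding_gal f (subvv E).
by exists c => x xE; have := hc (vsproj E x); rewrite /f /= !vsprojK.
Qed.

(** The indices follow the signature: 0 and 1 carry the real embeddings, 2 and 3
    the pair of complex conjugate ones. *)
Definition embeddings (h : 'I_4 -> gal_of E) :=
  [/\ forall g : gal_of E, exists i, {in K, g =1 h i},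
      forall i j, {in K, h i =1 h j} -> i = j,
      forall i x, real_index i -> x \in K -> phi (h i x) \is Num.real
    & forall x, x \in K -> phi (h i3 x) = (phi (h i2 x))^*].

Lemma embeddings_exist : has_signature (subvs_of K) 2 1 -> exists h, embeddings h.
Proof.
case=> rho [tau [rhoR tauR rhoI tauI all_emb]].
pose ctau : {rmorphism subvs_of K -> algC} :=
  (Num.conj : {rmorphism algC -> algC}) \o tau 0.
pose e (i : 'I_4) : {rmorphism subvs_of K -> algC} :=
  nth (rho 0) [:: rho 0; rho 1; tau 0; ctau] i.
have [h hE] : exists h : 'I_4 -> gal_of E, forall i, forall x, e i x = phi (h i (vsval x)).
  apply: (@fin_all_exists _ _ (fun i (g : gal_of E) => forall x, e i x = phi (g (vsval x)))).
  by move=> i; apply: embedding_gal.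
have hK i x : x \in K -> phi (h i x) = e i (vsproj K x) by move=> xK; rewrite hE vsprojK.
exists h; split.
- move=> g.
  pose f : {rmorphism subvs_of K -> algC} :=
    phi \o (gal_repr g : {rmorphism L -> L}) \o (vsval : {rmorphism subvs_of K -> L}).
  have [i ei] : exists i, f =1 e i.
    case: (all_emb f) => [[i]|[j]].
      case: i => [[|[|m]]] // lt_m ef; [exists i0|exists i1] => x; rewrite ef;
      by congr (rho _ _); apply: val_inj.
    rewrite [j]ord1 => -[] ef; [exists i2|exists i3] => x; by rewrite ef.
  exists i => x xK; apply: (fmorph_inj phi).
  by have := ei (vsproj K x); rewrite /f /= hE vsprojK.
- have tneq : tau 0 =1 ctau -> False.
    by case: (tauR 0) => x /negP xr /(_ x) /=; move/esym/CrealP.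
  have [z zr] := tauR 0.
  have rt i : rho i =1 tau 0 -> False by move=> /(_ z) ez; rewrite -ez rhoR in zr.
  have rc i : rho i =1 ctau -> False.
    by move=> /(_ z) /= ez; case/negP: zr; rewrite CrealE -ez; apply/eqP;
       rewrite -[LHS](CrealP (rhoR i z)) ez conjCK.
  have r01 : rho 0 =1 rho 1 -> False by move/rhoI.
  have sym (f g : {rmorphism subvs_of K -> algC}) : f =1 g -> g =1 f by move=> ? ?.
  move=> i j eij; have {eij} : e i =1 e j by move=> x; rewrite !hE eij ?subvsP.
  elim/I4_ind: i; elim/I4_ind: j => // ee; exfalso;
  solve [ exact: r01 ee | exact: r01 (sym _ _ ee) | exact: rt ee | exact: rt (sym _ _ ee)
    | exact: rc ee | exact: rc (sym _ _ ee) | exact: tneq ee | exact: tneq (sym _ _ ee) ].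
- by move=> i x; elim/I4_ind: i => // _ xK; rewrite hK //; apply: rhoR.
- by move=> x xK; rewrite !hK.
Qed.

Section Perm.
Variables (h : 'I_4 -> gal_of E) (hP : embeddings h).
Hypothesis (minE : forall F : {subfield L}, (K <= F)%VS -> galois 1 F -> (E <= F)%VS).

Definition acts_as (g : gal_of E) (s : 'S_4) :=
  forall i x, x \in K -> g (h i x) = h (s i) x.

Lemma acts_as_exists g : exists s, acts_as g s.
Proof.
have [cov inj _ _] := hP.
have inE x : x \in K -> x \in E by apply/subvP.
have [f fP] : exists f : 'I_4 -> 'I_4, forall i, {in K, (h i * g)%g =1 h (f i)}.
  by apply: (@fin_all_exists _ _ (fun i j => {in K, (h i * g)%g =1 h j})) => i; apply: cov.
have fI : injective f.
  move=> i j eij; apply: inj => x xK; apply: (fmorph_inj (gal_repr g : {rmorphism L -> L})).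
  by rewrite /= -!galM ?inE // fP // eij -fP.
by exists (perm fI) => i x xK; rewrite permE -fP // galM ?inE.
Qed.

Lemma acts_as_uniq g s t : acts_as g s -> acts_as g t -> s = t.
Proof.
have [_ inj _ _] := hP => gs gt; apply/permP=> i; apply: inj => x xK.
by rewrite -gs // gt.
Qed.

Lemma acts_asM g g' s t : acts_as g s -> acts_as g' t -> acts_as (g * g')%g (s * t)%g.
Proof.
move=> gs gt i x xK.
by rewrite permM galM ?memv_gal ?(subvP sKE) // gs // gt.
Qed.

(** Faithfulness is the minimality of the closure: the field fixed by the kernel
    is Galois and contains K. *)
Lemma galois_perm_group : exists A : {group 'S_4},
  [/\ 'Gal(E / 1%AS) \isog A,
      forall i j, exists2 s, s \in A & s i = j,
      tperm i2 i3 \in A,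
      forall g, exists2 s, s \in A & acts_as g s
    & forall s, s \in A -> exists g, acts_as g s].
Proof.
have [cov inj hreal hconj] := hP.
have [m mP] : exists m : gal_of E -> 'S_4, forall g, acts_as g (m g).
  by apply: (@fin_all_exists _ _ (fun g s => acts_as g s)) => g; apply: acts_as_exists.
have mM : {in 'Gal(E / 1%AS)%g &, {morph m : g k / (g * k)%g}}.
  by move=> g k _ _; apply: acts_as_uniq (mP _) (acts_asM (mP g) (mP k)).
pose M := Morphism mM.
(* One of the h_i is the inclusion of K, so the kernel fixes K pointwise. *)
have kerM : ('ker M = 1)%g.
  have galF : galois 1 (fixedField ('ker M)%g).
    by apply: normal_fixedField_galois => //; apply: ker_normal.
  have sKF : (K <= fixedField ('ker M)%g)%VS.
    apply/subvP=> x xK; apply/fixedFieldP; first exact: (subvP sKE).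
    move=> g /mker mg; have [i ei] := cov 1%g.
    have -> : x = h i x by rewrite -ei // gal_id.
    by rewrite (mP g) // [m g]mg perm1.
  have sEF := minE sKF galF.
  apply/trivgP/subsetP=> g gk; rewrite inE; apply/gal_eqP => x xE.
  rewrite gal_id; have := subvP sEF x xE; case/mem_fixedFieldP => _; exact.
have memM g : m g \in (M @* 'Gal(E / 1%AS))%g.
  by apply: mem_morphim; apply: all_gal.
exists (M @* 'Gal(E / 1%AS))%G; split=> /=.
- by apply: (sub_isog (f := M)) => //; rewrite kerM subxx.
- move=> i j; exists (m ((h i)^-1 * h j)%g) => //; apply: inj => x xK.
  have xE := subvP sKE x xK.
  by rewrite -(mP _ i x xK) galM ?memv_gal // -(galM (h i)) // mulgV gal_id.
- have [c cP] := conjC_gal; suff -> : tperm i2 i3 = m c by [].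
  apply: acts_as_uniq (mP c) => i x xK; apply: (fmorph_inj phi).
  have xE := subvP sKE x xK.
  rewrite cP ?memv_gal //.
  elim/I4_ind: i.
  + by rewrite tpermD //; apply: CrealP; apply: hreal.
  + by rewrite tpermD //; apply: CrealP; apply: hreal.
  + by rewrite tpermL hconj.
  + by rewrite tpermR hconj // conjCK.
- by move=> g; exists (m g).
- by move=> s /morphimP[g _ _ ->]; exists g.
Qed.

End Perm.
End Embeddings.

(** * The dihedral case *)

Lemma preperiodicM x : preperiodic x -> preperiodic (mahler x).
Proof. by case=> s hs; exists s => n; rewrite -iterSr. Qed.

Section QuarticField.
Variables (L : splittingFieldType rat) (phi : {rmorphism L -> algC}).
Variables (K E : {subfield L}) (galE : galois 1 E) (sKE : (K <= E)%VS).
Hypothesis dimK : \dim K = 4%N.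
Variables (h : 'I_4 -> gal_of E) (hP : embeddings phi K h).
Local Notation conjs := (conjs E).

Definition K_conjs (x : L) := [:: h i0 x; h i1 x; h i2 x; h i3 x].

Lemma mem_closure x : x \in K -> x \in E. Proof. exact/subvP. Qed.

Lemma K_conjsP x y : reflect (exists i, y = h i x) (y \in K_conjs x).
Proof.
rewrite !inE; apply: (iffP idP) => [/or4P[]/eqP->|[i ->]].
- by exists i0.
- by exists i1.
- by exists i2.
- by exists i3.
by elim/I4_ind: i; rewrite eqxx ?orbT.
Qed.

Lemma K_conjs_conjs x : x \in K -> K_conjs x =i conjs x.
Proof.
move=> xK y; apply/K_conjsP/conjsP => [[i ->]|[g ->]]; first by exists (h i).
by have [cov _ _ _] := hP; have [i e] := cov g; exists i; rewrite e.
Qed.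

(** The number of conjugates of x divides dim K = 4. *)
Lemma deg_le2_or_uniq x : x \in K -> deg_le2 E x \/ uniq (K_conjs x).
Proof.
move=> xK; have [|nu] := boolP (uniq (K_conjs x)); [by right | left].
have e := K_conjs_conjs xK.
have lt4 : (size (conjs x) < 4)%N.
  rewrite (_ : size (conjs x) = size (undup (K_conjs x))); last first.
    apply/perm_size/uniq_perm; rewrite ?undup_uniq ?conjs_uniq // => y.
    by rewrite -e mem_undup.
  by rewrite -[4%N]/(size (K_conjs x)) ltn_size_undup.
have /eq_add_S es := etrans (size_conjs galE (mem_closure xK)) (size_minPoly _ _).
have d4 : (size (conjs x) %| 4)%N.
  rewrite es adjoin_degreeE dimv1 divn1 -dimK.
  by apply: (field_dimS (F := <<1; x>>%AS)); apply/FadjoinP; rewrite sub1v.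
move: d4 lt4; rewrite /deg_le2; case: (size _) => [|[|[|[|n]]]] //.
Qed.

Local Notation r i x := `|phi (h i x)|.

Lemma r23 x : x \in K -> r i3 x = r i2 x.
Proof. by have [_ _ _ hc] := hP => xK; rewrite hc // norm_conjC. Qed.

Lemma perm_K_conjs x : x \in K -> uniq (K_conjs x) -> perm_eq (conjs x) (K_conjs x).
Proof.
by move=> xK u; apply: uniq_perm; rewrite ?conjs_uniq // => y; rewrite K_conjs_conjs.
Qed.

Lemma mahler_K x : x \in K -> uniq (K_conjs x) ->
  mahler (phi x) = (lead_coef (minZpoly (phi x)))%:~R *
   (Num.max 1 (r i0 x) * Num.max 1 (r i1 x) * Num.max 1 (r i2 x) * Num.max 1 (r i3 x)).
Proof.
move=> xK u; rewrite (mahler_conjs phi galE (mem_closure xK)).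
rewrite (perm_big _ (perm_K_conjs xK u)) /=.
by rewrite !big_cons big_nil mulr1 !mulrA.
Qed.

Lemma const_K x : x \in K -> uniq (K_conjs x) ->
  ((minZpoly (phi x))`_0)%:~R = (lead_coef (minZpoly (phi x)))%:~R *
   (phi (h i0 x) * phi (h i1 x) * phi (h i2 x) * phi (h i3 x)) :> algC.
Proof.
move=> xK u; rewrite (const_minZpoly phi galE (mem_closure xK)).
rewrite (perm_big _ (perm_K_conjs xK u)) /=.
by rewrite !big_cons big_nil; ring.
Qed.

Lemma uniq_K_conjs_neq0 x i : x \in K -> uniq (K_conjs x) -> h i x != 0.
Proof.
move=> xK; apply: contraTneq => /eqP; rewrite fmorph_eq0 => /eqP->.
by rewrite /K_conjs !rmorph0 /= !inE eqxx.
Qed.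

Lemma hK_real i x : real_index i -> x \in K -> phi (h i x) \is Num.real.
Proof. by have [_ _ hr _] := hP; apply: hr. Qed.

Lemma deg_le2_norm_preperiodic (a : int) y : a != 0 -> y \in E -> deg_le2 E y ->
  phi y \is Num.real -> preperiodic (`|a%:~R| * `|phi y|).
Proof.
move=> a0 yE sy yr; rewrite -normrM.
have aE : phi (a%:~R *: y) = a%:~R * phi y by rewrite phiZ ratr_int.
have [|c c1 ec] := @norm_phi_real _ phi (a%:~R *: y).
  by rewrite aE realM // Rreal_int ?intr_int.
rewrite -aE ec scalerA.
have c0 : c * a%:~R != 0 by rewrite mulf_neq0 ?intr_eq0 //; case: c1 => ->.
apply: (deg_le2_preperiodic phi galE); first by rewrite memvZ.
by rewrite /deg_le2 (perm_size (conjsZ c0 yE)) size_map.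
Qed.

Section Blocks.
Hypothesis blocks : forall g : gal_of E, exists2 s : 'S_4,
  real_index (s i2) = real_index (s i3) & acts_as K h g s.

Lemma deg_le2_block_products x : x \in K ->
  deg_le2 E (h i0 x * h i1 x) /\ deg_le2 E (h i2 x * h i3 x).
Proof.
move=> xK; set u := _ * _; set v := _ * _.
have stab (g : gal_of E) : (g u \in [:: u; v]) && (g v \in [:: u; v]).
  have [s bs sP] := blocks g.
  rewrite /u /v !rmorphM /= !sP //.
  have n01 : s i0 != s i1 by rewrite (inj_eq perm_inj).
  have n02 : s i0 != s i2 by rewrite (inj_eq perm_inj).
  have n03 : s i0 != s i3 by rewrite (inj_eq perm_inj).
  have n12 : s i1 != s i2 by rewrite (inj_eq perm_inj).
  have n13 : s i1 != s i3 by rewrite (inj_eq perm_inj).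
  have n23 : s i2 != s i3 by rewrite (inj_eq perm_inj).
  rewrite !inE /u /v; move: bs n01 n02 n03 n12 n13 n23.
  by elim/I4_ind: (s i0); elim/I4_ind: (s i1) => //;
     elim/I4_ind: (s i2) => //; elim/I4_ind: (s i3) => // *;
     rewrite ?eqxx ?orbT //= ?[h i1 x * h i0 x]mulrC ?[h i3 x * h i2 x]mulrC ?eqxx ?orbT.
split; apply: (@uniq_leq_size _ _ [:: u; v]); rewrite ?conjs_uniq // => y /conjsP[g ->];
  by have /andP[] := stab g.
Qed.

(** The eight cases are the positions of |x_0|, |x_1| and |x_2| = |x_3| with respect to
    1.  The set of indices outside the unit disc is empty or full (M(x) is an
    integer), one of the blocks (M(x) has at most two conjugates), one real index
    i (M(x) = |a x_i|), or all but one real index i (M(x) = |n / x_i|).  The real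
    index j inside the disc certifies that the last two cases stop occurring
    once both real conjugates are large. *)
Lemma mahler_step x : x \in K -> uniq (K_conjs x) ->
  let a := (lead_coef (minZpoly (phi x)))%:~R in
  let n := ((minZpoly (phi x))`_0)%:~R in
  preperiodic (mahler (phi x)) \/
  exists i, [/\ real_index i, exists2 j, real_index j & r j x <= 1
     & mahler (phi x) = `|a * phi (h i x)| \/ mahler (phi x) = `|n / phi (h i x)| ].
Proof.
move=> xK u; set a' := lead_coef _; set n' := _`_0 => a n.
have a1 : 1 <= a := lead_minZpoly_ge1 _.
have aN : `|a| = a by rewrite ger0_norm // (le_trans ler01).
have a0 : a' != 0 by rewrite -(intr_eq0 algC) gt_eqF // (lt_le_trans ltr01).
have hE i : h i x \in E by rewrite memv_gal ?mem_closure.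
have en : n = a * (phi (h i0 x) * phi (h i1 x) * phi (h i2 x) * phi (h i3 x)).
  by rewrite /n /n' const_K.
have nz i : phi (h i x) != 0 by rewrite fmorph_eq0 uniq_K_conjs_neq0.
have [s01 s23] := deg_le2_block_products xK.
have := mahler_K xK u; rewrite -/a' -/a (r23 xK).
case: (max1P (phi (h i0 x))) => x0; case: (max1P (phi (h i1 x))) => x1;
case: (max1P (phi (h i2 x))) => x2 Mx.
- by left; rewrite Mx !mulr1 -aN; apply: (preperiodic_norm_int phi galE).
- left; rewrite Mx mul1r mul1r -{2}(r23 xK) -normrM -rmorphM -aN.
  apply: deg_le2_norm_preperiodic => //; first by rewrite rpredM ?hE.
  have [_ _ _ hc] := hP; rewrite rmorphM /= hc //.
  by rewrite -normCK realX // normr_real.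
- right; exists i1; split=> //; first by exists i0.
  by left; rewrite Mx normrM aN; ring.
- right; exists i0; split=> //; first by exists i0.
  right; rewrite Mx en !normrM normfV aN (r23 xK); move: (nz i0) => nz0.
  by field; rewrite normr_eq0.
- right; exists i0; split=> //; first by exists i1.
  by left; rewrite Mx normrM aN; ring.
- right; exists i1; split=> //; first by exists i1.
  right; rewrite Mx en !normrM normfV aN (r23 xK); move: (nz i1) => nz1.
  by field; rewrite normr_eq0.
- left; rewrite Mx !mulr1 -normrM -rmorphM -aN.
  apply: deg_le2_norm_preperiodic => //; first by rewrite rpredM ?hE.
  by rewrite rmorphM realM ?hK_real.
- left; rewrite Mx (_ : _ * _ = `|n|); first exact: (preperiodic_norm_int phi galE).
  by rewrite en !normrM aN (r23 xK).
Qed.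

Lemma mahler_step_int x : x \in K -> uniq (K_conjs x) -> phi x \in Aint ->
  let n := ((minZpoly (phi x))`_0)%:~R in
  preperiodic (mahler (phi x)) \/
  exists i, [/\ real_index i, exists2 j, real_index j & r j x <= 1
     & mahler (phi x) = `|phi (h i x)| \/ mahler (phi x) = `|n / phi (h i x)| ].
Proof.
move=> xK u xA; have := mahler_step xK u; rewrite /= lead_minZpoly_Aint //.
by case=> [|[i]]; [left | rewrite mul1r; right; exists i].
Qed.

Lemma mahler_sign c x : c = 1 \/ c = -1 :> rat -> x \in E -> phi x \in Aint ->
  mahler (phi (c *: x)) = mahler (phi x).
Proof.
move=> c1 xE xA.
have c0 : c != 0 by case: c1 => ->.
have cxA : phi (c *: x) \in Aint.
  by case: c1 => ->; rewrite ?scaleN1r ?scale1r // rmorphN rpredN.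
rewrite !(mahler_conjs phi galE) ?memvZ // !lead_minZpoly_Aint //.
rewrite (perm_big _ (conjsZ c0 xE)) big_map /=; congr (_ * _).
apply: eq_bigr => y _; congr (Num.max 1 _).
by case: c1 => ->; rewrite ?scaleN1r ?scale1r // rmorphN normrN.
Qed.

Lemma norm_embedding i x : real_index i -> x \in K ->
  exists2 c : rat, c = 1 \/ c = -1 & `|phi (h i x)| = phi (h i (c *: x)).
Proof.
move=> ir xK; have [c c1 e] := norm_phi_real (hK_real ir xK).
by exists c => //; rewrite linearZ.
Qed.

(** Up to sign |x_i| is a conjugate of x. *)
Lemma mahler_norm_embedding i x : real_index i -> x \in K -> phi x \in Aint ->
  mahler `|phi (h i x)| = mahler (phi x).
Proof.
move=> ir xK xA; have [c c1 ->] := norm_embedding ir xK.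
by rewrite (mahler_gal phi galE) ?memvZ ?mem_closure // mahler_sign ?mem_closure.
Qed.

(** In the only case that does not stop at once, M(b) is up to sign a conjugate of
    b' = n / b, where n is the norm of b; then b' has norm n^3, and M(b') is
    either already treated or up to sign a conjugate of b2 = n^3 / b' = n^2 b.  If
    |n| = 1 this closes a cycle of length 2; otherwise the conjugates of b2 are at
    least 4 times those of b, which lowers k. *)
Lemma preperiodic_of_growth k b : b \in K -> phi b \in Aint ->
  (forall j, real_index j -> 1 < 2 ^+ k * r j b) -> preperiodic (phi b).
Proof.
elim: k b => [|k IH] b bK bA hk.
all: have [sb|ub] := deg_le2_or_uniq bK;
  first exact: (deg_le2_preperiodic phi galE (mem_closure bK)).
all: case: (mahler_step_int bK ub bA) => [/preperiodic_mahler//|[i [ri [j rj j1] Mb]]].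
  by have := hk j rj; rewrite expr0 mul1r => /lt_le_trans/(_ j1); rewrite ltxx.
have fixed x l : x \in K -> phi x \in Aint -> real_index l ->
    mahler (phi x) = `|phi (h l x)| -> preperiodic (phi x).
  move=> xK xA rl Mx; apply: preperiodic_mahler.
  by apply: (@periodic_preperiodic 0); rewrite /= {1}Mx mahler_norm_embedding.
case: Mb => Mb; first by apply: (fixed b i).
set n := (minZpoly (phi b))`_0 in Mb.
have en := const_K bK ub; rewrite lead_minZpoly_Aint // mul1r -/n in en.
have nz l : phi (h l b) != 0 by rewrite fmorph_eq0 uniq_K_conjs_neq0.
have n0 : n%:~R != 0 :> algC by rewrite en !mulf_neq0.
pose b' := n%:~R / b.
have b'K : b' \in K by rewrite rpred_div // rpred_int.
have hb' l : phi (h l b') = n%:~R / phi (h l b) by rewrite !rmorphM /= !rmorph_int !fmorphV.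
have pb' : phi b' = n%:~R / phi b by rewrite rmorphM /= rmorph_int fmorphV.
have b'A : phi b' \in Aint.
  by rewrite pb'; apply: Aint_const_div; have [] := minZpolyP (phi b).
have MMb : mahler (mahler (phi b)) = mahler (phi b').
  by rewrite Mb -hb' mahler_norm_embedding.
suff pM : preperiodic (mahler (phi b')) by do 2!apply: preperiodic_mahler; rewrite MMb.
have [sb'|ub'] := deg_le2_or_uniq b'K.
  exact/preperiodicM/(deg_le2_preperiodic phi galE (mem_closure b'K)).
case: (mahler_step_int b'K ub' b'A) => [//|[m [rm _ Mb']]].
case: Mb' => Mb'; first by apply: preperiodicM; apply: (fixed b' m).
set n' := (minZpoly (phi b'))`_0 in Mb'.
have en' : n'%:~R = n%:~R ^+ 3 :> algC.
  have := const_K b'K ub'; rewrite lead_minZpoly_Aint // mul1r -/n' => ->.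
  by rewrite !hb' {4}en; rewrite en in n0 *; field; rewrite ?nz.
pose b2 := (n ^+ 2)%:~R * b.
have b2K : b2 \in K by rewrite rpredM // rpred_int.
have hb2 l : phi (h l b2) = n%:~R ^+ 2 * phi (h l b).
  by rewrite !rmorphM /= !rmorph_int.
have b2A : phi b2 \in Aint by rewrite rmorphM /= rmorph_int rpredM // Aint_int.
have Mb'2 : mahler (phi b') = `|phi (h m b2)|.
  by rewrite Mb' hb' en' hb2; congr `|_|; move: (nz m) => nzm; field; rewrite n0 nzm.
have MMb' : mahler (mahler (phi b')) = mahler (phi b2).
  by rewrite Mb'2 mahler_norm_embedding.
have nZ : n != 0 by rewrite -(intr_eq0 algC).
have [n1|n2] := leqP `|n|%N 1.
  have b2b : b2 = b.
    have -> : b2 = (n ^+ 2)%:~R * b by [].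
    rewrite -(real_normK (num_real n)) -abszE (_ : `|n|%N = 1%N) ?expr1n ?mul1r //.
    by apply/eqP; rewrite eqn_leq n1 absz_gt0.
  apply: (@periodic_preperiodic 1); rewrite /= MMb' b2b.
  exact: MMb.
apply: preperiodic_mahler; rewrite MMb'; apply: preperiodicM.
apply: IH => // l rl; apply: lt_le_trans (hk l rl) _.
rewrite hb2 normrM mulrA ler_wpM2r // exprSr ler_wpM2l ?exprn_ge0 //.
rewrite normrX -intr_norm -natr_absz -natrX ler_nat.
by rewrite (leq_trans n2) // leq_pmulr // ltnW.
Qed.

Lemma preperiodic_K_int b : b \in K -> phi b \in Aint -> preperiodic (phi b).
Proof.
move=> bK bA; have [->|b0] := eqVneq b 0.
  by rewrite rmorph0; apply: (preperiodic_nat phi galE 0).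
have rp j : 0 < r j b by rewrite normr_gt0 !fmorph_eq0.
pose N j := Num.bound (r j b)^-1.
apply: (@preperiodic_of_growth (maxn (N i0) (N i1))) => // j rj.
rewrite -ltr_pdivrMr // mul1r -natrX.
apply: lt_le_trans (archi_boundP _) _; first by rewrite invr_ge0 ltW.
rewrite ler_nat -/(N j); apply: leq_trans (ltnW (ltn_expl _ (isT : 1 < 2)%N)) _.
rewrite leq_exp2l //.
by elim/I4_ind: j rj => // _; rewrite ?leq_maxl ?leq_maxr.
Qed.

(** After one step the orbit either is known to be finite or consists, up to
    sign and conjugation, of an algebraic integer of K. *)
Lemma preperiodic_K x : x \in K -> preperiodic (phi x).
Proof.
move=> xK; have [sx|ux] := deg_le2_or_uniq xK.
  exact: (deg_le2_preperiodic phi galE (mem_closure xK)).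
have key b i : b \in K -> phi b \in Aint -> real_index i -> 
    preperiodic `|phi (h i b)|.
  move=> bK bA ri; apply: preperiodic_mahler; rewrite mahler_norm_embedding //.
  exact/preperiodicM/preperiodic_K_int.
have := mahler_step xK ux; set a := lead_coef _; set n := _`_0 => /=.
have rx := root_minZpoly_conjs phi galE (mem_closure xK) (mem_conjs E x).
case=> [/preperiodic_mahler//|[i [ri _ Mx]]]; apply: preperiodic_mahler.
case: Mx => ->.
  have <- : phi (h i (a%:~R * x)) = a%:~R * phi (h i x).
    by rewrite !rmorphM /= !rmorph_int.
  apply: key => //; first by rewrite rpredM // rpred_int.
  by rewrite rmorphM /= rmorph_int; apply: Aint_lead_mul.
have <- : phi (h i (n%:~R / x)) = n%:~R / phi (h i x).
  by rewrite !rmorphM /= !rmorph_int !fmorphV.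
apply: key => //; first by rewrite rpred_div // rpred_int.
by rewrite rmorphM /= rmorph_int fmorphV; apply: Aint_const_div.
Qed.

End Blocks.
End QuarticField.

(** * Squaring of the expanding conjugate under the second iterate *)

Section Wandering.
Variables (L : splittingFieldType rat) (phi : {rmorphism L -> algC}).
Variables (E : {subfield L}) (galE : galois 1 E).
Local Notation conjs := (conjs E).
Local Notation r v i := `|phi (v i)|.

(** The situation of the four conjugates of a unit of K, up to exchanging the two
    real places; it is stated for a family so that squaring preserves it. *)
Record expanding_orbit (v : 'I_4 -> L) : Prop := ExpandingOrbit {
  eo_E : forall i, v i \in E;
  eo_Aint : forall i, phi (v i) \in Aint;
  eo_norm : r v i0 * r v i1 * r v i2 * r v i3 = 1;
  eo_trans2 : forall i j, i != j ->
     exists g : gal_of E, g (v i0) = v i /\ g (v i1) = v j;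
  eo_perm : forall g : gal_of E, exists s : 'S_4, forall i, g (v i) = v (s i);
  eo_real : forall i, real_index i -> phi (v i) \is Num.real;
  eo_r23 : r v i3 = r v i2;
  eo_gt1 : 1 < r v i1;
  eo_lt : r v i1 < r v i0 }.

Lemma expanding_orbit_sqr v : expanding_orbit v -> expanding_orbit (fun i => v i ^+ 2).
Proof.
case=> vE vA vN vt vp vr v23 v1 v01; split.
- by move=> i; rewrite rpredX ?vE.
- by move=> i; rewrite rmorphXn rpredX ?vA.
- by rewrite !rmorphXn !normrX -!exprMn vN expr1n.
- by move=> i j /vt[g [g0 g1]]; exists g; rewrite !rmorphXn /= g0 g1.
- by move=> g; have [s sP] := vp g; exists s => i; rewrite rmorphXn /= sP.
- by move=> i ri; rewrite rmorphXn realX ?vr.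
- by rewrite !rmorphXn !normrX v23.
- by rewrite rmorphXn normrX /= exprn_egt1.
- by rewrite !rmorphXn !normrX ltr_pXn2r // nnegrE normr_ge0.
Qed.

(** With r_i = |v_i| we have r_0 > r_1 > 1 > r_2 = r_3.  So M(v_0) = r_0 r_1 and the
    six products v_i v_j are its distinct conjugates up to sign.  As
    (r_0 r_2) (r_1 r_2) = 1 and r_0 r_2 > r_1 r_2, the products outside the unit
    disc are exactly those containing v_0. *)
Lemma mahler2_expanding v : expanding_orbit v ->
  mahler (mahler (phi (v i0))) = phi (v i0) ^+ 2.
Proof.
case=> vE vA vN vt vp vr v23 v1 v01.
have p1 : 0 < r v i1 := lt_trans ltr01 v1.
have p0 : 0 < r v i0 := lt_trans p1 v01.
have v0 : 1 < r v i0 := lt_trans v1 v01.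
rewrite v23 in vN.
have p2 : 0 < r v i2.
  rewrite lt_def normr_ge0 andbT; apply/eqP=> e; move: vN; rewrite e !mulr0 => /eqP.
  by rewrite eq_sym oner_eq0.
have v2 : r v i2 < 1.
  have [//|le] := real_ltP (normr_real (phi (v i2))) (real1 _).
  suff : 1 < r v i0 * r v i1 * r v i2 * r v i2 by rewrite vN ltxx.
  have h01 : 1 < r v i0 * r v i1 by apply: mulr_ge1_gt1 => //; apply: ltW.
  rewrite -mulrA mulrC; apply: mulr_ge1_gt1 => //.
  by rewrite -[1]mulr1 ler_pM.
(* A coincidence between two of the v_i would spread to v_0 = v_1. *)
have vI : injective v.
  move=> i j eij; apply/eqP/negP => /negP /vt[g [g0 g1]].
  have : v i0 = v i1.
    by apply: (fmorph_inj (gal_repr g : {rmorphism L -> L})); rewrite /= g0 g1.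
  by move=> e; rewrite e ltxx in v01.
have Mv : mahler (phi (v i0)) = r v i0 * r v i1.
  pose s := [:: v i0; v i1; v i2; v i3].
  have us : uniq s by rewrite /= !inE !(inj_eq vI).
  have es : s =i conjs (v i0).
    move=> y; apply/idP/conjsP => [|[g ->]]; last first.
      have [t ->] := vp g; rewrite !inE !(inj_eq vI).
      by elim/I4_ind: (t i0).
    have get i : exists g : gal_of E, v i = g (v i0).
      have [j ij] : exists j, i != j.
        by elim/I4_ind: i; [exists i1 | exists i0 | exists i0 | exists i0].
      by have [g [g0 _]] := vt i j ij; exists g.
    by rewrite !inE => /or4P[]/eqP->; apply: get.
  rewrite (mahler_Aint galE (vE i0) (vA i0) us es) !big_cons big_nil mulr1.
  have le1 i : r v i <= 1 -> Num.max 1 (r v i) = 1 by move/max_l.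
  have ge1 i : 1 < r v i -> Num.max 1 (r v i) = r v i by move/ltW/max_r.
  by rewrite v23 (ge1 i0) // (ge1 i1) // (le1 i2) ?mulr1 // ltW.
have rw : phi (v i0 * v i1) \is Num.real by rewrite rmorphM realM ?vr.
have [c c1 ec] := norm_phi_real rw.
have c0 : c != 0 by case: c1 => ->.
have cN x : `|phi (c *: x)| = `|phi x|.
  by case: c1 => ->; rewrite ?scale1r // scaleN1r rmorphN normrN.
rewrite Mv -normrM -rmorphM ec.
pose ps := [:: v i0 * v i1; v i0 * v i2; v i0 * v i3; v i1 * v i2; v i1 * v i3; v i2 * v i3].
have wE : v i0 * v i1 \in E by rewrite rpredM.
have wA : phi (c *: (v i0 * v i1)) \in Aint.
  by case: c1 => ->; rewrite ?scale1r ?scaleN1r ?rmorphN ?rpredN rmorphM rpredM.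
have lt i j k l : r v i * r v j < r v k * r v l ->
    (v i * v j == v k * v l = false) * (v k * v l == v i * v j = false).
  move=> h; have n : v i * v j != v k * v l.
    by apply/eqP=> /(congr1 (fun x => `|phi x|)); rewrite !rmorphM !normrM => e;
       rewrite e ltxx in h.
  by split; [apply/negbTE | rewrite eq_sym; apply/negbTE].
(* The six products have absolute values A = r_0 r_1 > B = r_0 r_2 >
   C = r_1 r_2 > D = r_2 r_2, with B and C taken twice. *)
have AB : r v i0 * r v i2 < r v i0 * r v i1.
  by rewrite ltr_pM2l // (lt_trans v2).
have BC : r v i1 * r v i2 < r v i0 * r v i2 by rewrite ltr_pM2r.
have CD : r v i2 * r v i2 < r v i1 * r v i2 by rewrite ltr_pM2r // (lt_trans v2).
have AC := lt_trans BC AB; have AD := lt_trans CD AC; have BD := lt_trans CD BC.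
have nz i : v i != 0.
  by rewrite -(fmorph_eq0 phi) -normr_gt0; elim/I4_ind: i; rewrite ?v23.
have e23 i : (v i * v i2 == v i * v i3 = false) by rewrite (inj_eq (mulfI (nz i))) (inj_eq vI).
have ups : uniq ps.
  rewrite /= !inE !negb_or !e23.
  by rewrite !(lt i0 i2 i0 i1, lt i0 i3 i0 i1, lt i1 i2 i0 i1, lt i1 i3 i0 i1, lt i2 i3 i0 i1,
     lt i1 i2 i0 i2, lt i1 i3 i0 i2, lt i2 i3 i0 i2, lt i1 i2 i0 i3, lt i1 i3 i0 i3,
     lt i2 i3 i0 i3, lt i2 i3 i1 i2, lt i2 i3 i1 i3) ?v23.
have pair_ps i j : i != j -> v i * v j \in ps.
  wlog lt_ij : i j / (i < j)%N => [hw|_].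
    move=> nij; have := nij; rewrite -val_eqE neq_ltn => /orP[/hw|/hw]; first exact.
    by rewrite mulrC; apply; rewrite eq_sym.
  by elim/I4_ind: i lt_ij; elim/I4_ind: j => // _; rewrite !inE eqxx ?orbT.
have cps : map ( *:%R c) ps =i conjs (c *: (v i0 * v i1)).
  move=> y; rewrite (perm_mem (conjsZ c0 wE)); apply: eq_mem_map => {}y.
  apply/idP/conjsP=> [|[g ->]]; last first.
    by have [t tP] := vp g; rewrite rmorphM /= !tP pair_ps // (inj_eq perm_inj).
  have get i j : i != j -> exists g : gal_of E, v i * v j = g (v i0 * v i1).
    by move=> /vt[g [g0 g1]]; exists g; rewrite rmorphM /= g0 g1.
  by rewrite !inE => /or4P[/eqP->|/eqP->|/eqP->|/or3P[]/eqP->]; apply: get.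
have cuniq : uniq (map ( *:%R c) ps) by rewrite map_inj_uniq //; apply: scalerI.
have cwE : c *: (v i0 * v i1) \in E by rewrite memvZ.
rewrite (mahler_Aint galE cwE wA cuniq cps) big_map !big_cons big_nil mulr1.
rewrite !cN !rmorphM !normrM v23.
have BC1 : (r v i0 * r v i2) * (r v i1 * r v i2) = 1 by rewrite -vN; ring.
have B1 : 1 < r v i0 * r v i2.
  have rr := realM (normr_real (phi (v i0))) (normr_real (phi (v i2))).
  have [//|le] := real_ltP (real1 _) rr.
  have : r v i1 * r v i2 < 1 by apply: lt_le_trans BC le.
  move=> C1; have := BC1; move: le C1; set B := _ * _; set C := _ * _ => le C1 e.
  have : B * C < 1.
    by apply: le_lt_trans C1; rewrite ler_piMl // mulr_ge0.
  by rewrite e ltxx.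
have C1 : r v i1 * r v i2 < 1.
  rewrite -BC1 ltr_pMl // mulr_gt0 //.
have D1 := lt_trans CD C1.
rewrite !(max_r (ltW B1)) !(max_l (ltW C1)) (max_l (ltW D1)) !mulr1.
rewrite (max_r (ltW (lt_trans B1 AB))) -real_normK ?vr //.
by rewrite -[RHS]mulr1 -vN; ring.
Qed.

Lemma expanding_iter k v : expanding_orbit v ->
  iter (2 * k) mahler (phi (v i0)) = phi (v i0) ^+ (2 ^ k).
Proof.
elim: k v => [|k IH] v vP; first by rewrite muln0.
rewrite mulnS addnC iterD /= mahler2_expanding // -rmorphXn.
by rewrite (IH _ (expanding_orbit_sqr vP)) rmorphXn -exprM -expnS.
Qed.

Lemma expanding_wandering v : expanding_orbit v -> wandering (phi (v i0)).
Proof.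
move=> vP [s sP]; pose f k := iter (2 * k) mahler (phi (v i0)).
have v0 : 1 < r v i0 := lt_trans (eo_gt1 vP) (eo_lt vP).
have fI : injective f.
  move=> k l; rewrite /f !expanding_iter // => /(congr1 (fun z => `|z|)).
  rewrite !normrX => /ieexprIn e; apply/eqP; rewrite -(@eqn_exp2l 2) //; apply/eqP.
  by apply: e; rewrite ?(lt_trans ltr01) // gt_eqF.
have : (size (map f (iota 0 (size s).+1)) <= size s)%N.
  apply: uniq_leq_size; first by rewrite map_inj_uniq ?iota_uniq.
  by move=> _ /mapP[k _ ->]; apply: sP.
by rewrite size_map size_iota ltnn.
Qed.

End Wandering.

(** * A unit with two large real conjugates *)

Lemma truncn_eq_dist (s t : algC) :
  0 <= s -> 0 <= t -> Num.truncn s = Num.truncn t -> `|s - t| < 1.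
Proof.
move=> s0 t0 e; have /andP[ls us] := truncn_itv s0; have /andP[lt ut] := truncn_itv t0.
rewrite e in ls us; rewrite real_ltr_norml ?rpredB ?ger0_real //.
rewrite ltrBlDr ltrBrDl ltrBlDr addrC; apply/andP; split.
  by apply: lt_le_trans ut _; rewrite -natr1 addrC lerD2r.
by apply: lt_le_trans us _; rewrite -natr1 addrC lerD2l.
Qed.

Section Unit.
Variables (L : splittingFieldType rat) (phi : {rmorphism L -> algC}).
Variables (K E : {subfield L}) (galE : galois 1 E) (sKE : (K <= E)%VS).
Hypothesis dimK : \dim K = 4%N.
Variables (h : 'I_4 -> gal_of E) (hP : embeddings phi K h).

Lemma Aint_multiple (x : L) : exists2 a : int, a != 0 & phi (a%:~R * x) \in Aint.
Proof.
have [rx _ _ l0] := minZpolyP (phi x).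
exists (lead_coef (minZpoly (phi x))); first by rewrite gt_eqF.
by rewrite rmorphM /= rmorph_int; apply: Aint_lead_mul.
Qed.

(** Clear the denominators of a rational basis of K. *)
Lemma int_basis_exists : exists w : 'I_4 -> L,
  [/\ forall i, w i \in K, forall i, phi (w i) \in Aint
    & forall c : 'I_4 -> int, \sum_i (c i)%:~R * w i = 0 -> forall i, c i = 0].
Proof.
have [b bK bfree] : exists2 b : 'I_4 -> L, forall i, b i \in K
    & forall k : 'I_4 -> rat, \sum_i k i *: b i = 0 -> forall i, k i = 0.
  have := vbasisP K; move: (vbasis K); rewrite dimK => X bX.
  exists (fun i => X`_i).
    by move=> i; apply: (basis_mem bX); apply: mem_nth; rewrite size_tuple.
  by apply/freeP; apply: basis_free bX.
have [a aP] : exists a : 'I_4 -> int, forall i, a i != 0 /\ phi ((a i)%:~R * b i) \in Aint.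
  apply: (@fin_all_exists _ _ (fun i (a : int) => a != 0 /\ phi (a%:~R * b i) \in Aint)).
  by move=> i; have [a] := Aint_multiple (b i); exists a.
exists (fun i => (a i)%:~R * b i); split.
- by move=> i; rewrite rpredM ?rpred_int.
- by move=> i; have [] := aP i.
move=> c e i; have [a0 _] := aP i.
have /eqP : (c i * a i)%:~R = 0 :> rat.
  apply: (bfree (fun i => (c i * a i)%:~R)); rewrite -[RHS]e; apply: eq_bigr => j _.
  by rewrite -mulr_algl -[_%:A]/(in_alg L _) rmorph_int intrM mulrA.
by rewrite intr_eq0 mulf_eq0 (negbTE a0) orbF => /eqP.
Qed.

(** The norm is fixed by the Galois group and is an algebraic integer. *)
Lemma gal_norm_int x : x \in K -> phi x \in Aint ->
  exists n : int, n%:~R = \prod_i phi (h i x).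
Proof.
move=> xK xA; have xE := subvP sKE x xK.
suff /intrP[n ->] : \prod_i phi (h i x) \in Num.int by exists n.
apply: Cint_rat_Aint; last first.
  by apply: rpred_prod => i _; rewrite (Aint_gal phi galE).
rewrite -rmorph_prod /=.
have : \prod_i h i x \in fixedField 'Gal(E / 1%AS)%g.
  apply/fixedFieldP; first by apply: rpred_prod => i _; apply: memv_gal.
  move=> g _; have [s sP] := acts_as_exists sKE hP g.
  rewrite rmorph_prod /= [RHS](reindex_inj (@perm_inj _ s)) /=.
  by apply: eq_bigr => i _; rewrite sP.
rewrite (galois_fixedField galE) => /vlineP[k ->].
by rewrite phiZ rmorph1 mulr1; apply: Crat_rat.
Qed.

(** The quotient of the norm by x is the product of the other conjugates. *)
Lemma norm_div_Aint x n : x \in K -> phi x \in Aint -> x != 0 ->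
  n%:~R = \prod_i phi (h i x) -> n%:~R / phi x \in Aint.
Proof.
move=> xK xA x0 ->; have [cov _ _ _] := hP; have [l hl] := cov 1%g.
have -> : phi x = phi (h l x) by rewrite -hl // gal_id.
rewrite (bigD1 l) //= mulrAC mulfV ?mul1r ?fmorph_eq0 //.
by apply: rpred_prod => i _; rewrite (Aint_gal phi galE) ?(subvP sKE).
Qed.

Section Pigeonhole.
Variables (w : 'I_4 -> L) (wK : forall i, w i \in K) (wA : forall i, phi (w i) \in Aint).
Hypothesis wfree : forall c : 'I_4 -> int,
   \sum_i (c i)%:~R * w i = 0 -> forall i, c i = 0.

Definition icomb (c : {ffun 'I_4 -> int}) : L := \sum_i (c i)%:~R * w i.

Lemma icombK c : icomb c \in K.
Proof. by apply: rpred_sum => i _; rewrite rpredM ?rpred_int. Qed.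

Lemma icombA c : phi (icomb c) \in Aint.
Proof.
rewrite rmorph_sum; apply: rpred_sum => i _ /=.
by rewrite rmorphM /= rmorph_int rpredM ?Aint_int.
Qed.

Lemma phi_icomb j c : phi (h j (icomb c)) = \sum_i (c i)%:~R * phi (h j (w i)).
Proof.
rewrite !rmorph_sum; apply: eq_bigr => i _ /=.
by rewrite !rmorphM /= !rmorph_int.
Qed.

Local Notation r j c := `|phi (h j (icomb c))|.

Lemma coef_bound : exists2 B : nat, (0 < B)%N & forall i j, `|phi (h j (w i))| <= B%:R.
Proof.
pose N i j := Num.bound `|phi (h j (w i))|.
exists (\sum_i \sum_j N i j).+1 => // i j.
apply: ltW; apply: lt_le_trans (archi_boundP (normr_ge0 _)) _.
rewrite ler_nat -/(N i j) (bigD1 i) //= (bigD1 j) //= -!addnA.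
by apply: leqW; apply: leq_addr.
Qed.

Lemma icomb_neq0 c : c != 0 -> icomb c != 0.
Proof.
apply: contraNneq => /wfree c0; apply/eqP/ffunP => i.
by rewrite c0 ffunE.
Qed.

Lemma icombB c c' : icomb (c - c') = icomb c - icomb c'.
Proof.
rewrite /icomb -sumrB; apply: eq_bigr => i _.
by rewrite !ffunE rmorphB mulrBl.
Qed.

Lemma real_icomb j c : real_index j -> phi (h j (icomb c)) \is Num.real.
Proof. by have [_ _ hr _] := hP => rj; apply: hr (icombK c). Qed.

Lemma r23_icomb c : r i3 c = r i2 c.
Proof. by have [_ _ _ hc] := hP; rewrite hc ?icombK // norm_conjC. Qed.

Lemma icomb_bound (B H : nat) (c : {ffun 'I_4 -> int}) j :
  (forall i j, `|phi (h j (w i))| <= B%:R) ->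
  (forall i, `|c i| <= H%:Z) -> r j c <= (4 * B * H)%N%:R.
Proof.
move=> wB cH; rewrite phi_icomb; apply: le_trans (ler_norm_sum _ _ _) _.
rewrite (_ : (4 * B * H)%N%:R = \sum_(i < 4) B%:R * H%:R); last first.
  by rewrite sumr_const card_ord !natrM -[RHS]mulr_natl mulrA.
apply: ler_sum => i _; rewrite normrM mulrC ler_pM //.
by rewrite -intr_norm -[H%:R]/((H%:Z)%:~R) ler_int.
Qed.

(** Pigeonhole: the (H + 1)^4 integer combinations with coefficients in 0..H
    have real conjugates of size at most 4 B H.  Cutting both intervals into
    pieces of length 8 B / H gives (H^2 + 1)^2 boxes, which is fewer, so two
    combinations share a box; their difference is wanted. *)
Lemma small_pair_exists (B H : nat) : (0 < B)%N -> (0 < H)%N ->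
  (forall i j, `|phi (h j (w i))| <= B%:R) ->
  exists c : {ffun 'I_4 -> int}, [/\ c != 0, forall i, `|c i| <= H%:Z
    & forall j, real_index j -> r j c < (8 * B)%N%:R / H%:R].
Proof.
move=> B0 H0 wB.
have B0' : 0 < (8 * B)%N%:R :> algC by rewrite ltr0n muln_gt0.
have H0' : 0 < H%:R :> algC by rewrite ltr0n.
pose iv (c : {ffun 'I_4 -> 'I_H.+1}) : {ffun 'I_4 -> int} := [ffun i => (c i : nat)%:Z].
pose t j c := (phi (h j (icomb (iv c))) + (4 * B * H)%N%:R) * (H%:R / (8 * B)%N%:R).
have q0 : 0 < H%:R / (8 * B)%N%:R :> algC by rewrite divr_gt0.
have xb j c : real_index j ->
    - (4 * B * H)%N%:R <= phi (h j (icomb (iv c))) <= (4 * B * H)%N%:R.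
  move=> rj; rewrite -real_ler_norml ?real_icomb //; apply: icomb_bound => // i.
  by rewrite ffunE ger0_norm // lez_nat -ltnS.
have t0 j c : real_index j -> 0 <= t j c.
  by move=> /(xb j c)/andP[l _]; rewrite mulr_ge0 ?(ltW q0) // -lerBlDr sub0r.
have tH j c : real_index j -> t j c <= (H ^ 2)%N%:R.
  move=> /(xb j c)/andP[_ u].
  have -> : (H ^ 2)%N%:R = ((4 * B * H)%N%:R + (4 * B * H)%N%:R)
                           * (H%:R / (8 * B)%N%:R) :> algC.
    rewrite -natrD addnn -mul2n natrX !natrM.
    by field; rewrite ?pnatr_eq0 -?lt0n ?B0.
  by rewrite ler_wpM2r ?(ltW q0) // lerD2r.
have tN j c : real_index j -> (Num.truncn (t j c) < (H ^ 2).+1)%N.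
  move=> rj; rewrite ltnS -(ler_nat algC); apply: le_trans (tH j c rj).
  by have /andP[] := truncn_itv (t0 j c rj).
pose F c : 'I_(H ^ 2)%N.+1 * 'I_(H ^ 2)%N.+1 :=
  (inord (Num.truncn (t i0 c)), inord (Num.truncn (t i1 c))).
have /injectivePn[c [c' nc eF]] : ~~ injectiveb F.
  apply/injectiveP => /leq_card; rewrite card_prod card_ffun !card_ord.
  rewrite leqNgt => /negP; apply.
  rewrite mulnn (_ : 4 = 2 * 2)%N // expnM ltn_exp2r //.
  by rewrite -(addn1 H) sqrnD exp1n muln1 addn1 -[X in (X < _)%N]addn0 ltn_add2l muln_gt0.
exists (iv c - iv c'); split.
- apply: contraNneq nc => /eqP; rewrite subr_eq0 => /eqP e; apply/eqP/ffunP=> i.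
  by have /ffunP/(_ i) := e; rewrite !ffunE => -[] /val_inj.
- move=> i; rewrite !ffunE ler_norml.
  have := ltn_ord (c i); have := ltn_ord (c' i); rewrite !ltnS.
  move: (c i : nat) (c' i : nat) => m m' lm' lm.
  rewrite lerBlDr lerBrDr; apply/andP; split.
    by rewrite addrC lerBlDr -PoszD lez_nat (leq_trans lm') ?leq_addl.
  by rewrite -PoszD lez_nat (leq_trans lm) ?leq_addr.
move=> j rj; have et : Num.truncn (t j c) = Num.truncn (t j c').
  case: eF => /(congr1 val) /= e0 /(congr1 val) /= e1.
  by elim/I4_ind: j rj => // _; [move: e0 | move: e1]; rewrite !inordK ?tN.
have := truncn_eq_dist (t0 j c rj) (t0 j c' rj) et.
rewrite /t -mulrBl opprD addrACA subrr addr0 -!rmorphB -icombB normrM.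
rewrite [X in _ * X]ger0_norm ?(ltW q0) // -ltr_pdivlMr // invf_div mul1r.
exact.
Qed.

(** The two small real conjugates, of size 8 B / H, compensate the two complex
    ones, of size at most 4 B H, so the norm is bounded independently of H. *)
Lemma small_icomb_exists : exists T : nat, forall e0 e1 : algC, 0 < e0 -> 0 < e1 ->
  exists c, [/\ icomb c != 0, r i0 c < e0, r i1 c < e1
    & `|\prod_j phi (h j (icomb c))| <= T%:R].
Proof.
have [B B0 wB] := coef_bound.
exists ((32 * B ^ 2) ^ 2)%N => e0 e1 p0 p1.
pose N (e : algC) := Num.bound ((8 * B)%N%:R / e).
pose H := (N e0 + N e1)%N.+1.
have [c [c0 cH cs]] := @small_pair_exists B H B0 isT wB.
have small e : 0 < e -> (N e <= H)%N -> (8 * B)%N%:R / H%:R < e.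
  move=> e_gt0 NH; rewrite ltr_pdivrMr ?ltr0n // mulrC -ltr_pdivrMr //.
  apply: lt_le_trans (archi_boundP _) _; first by rewrite divr_ge0 // ltW.
  by rewrite ler_nat.
exists c; split; first exact: icomb_neq0.
- by apply: lt_trans (cs i0 isT) (small _ p0 _); rewrite leqW ?leq_addr.
- by apply: lt_trans (cs i1 isT) (small _ p1 _); rewrite leqW ?leq_addl.
have -> : \prod_j phi (h j (icomb c)) = phi (h i0 (icomb c)) * phi (h i1 (icomb c))
    * (phi (h i2 (icomb c)) * phi (h i3 (icomb c))).
  rewrite !big_ord_recl big_ord0 mulr1 -mulrA.
  by congr (phi (h _ _) * (phi (h _ _) * (phi (h _ _) * phi (h _ _)))); apply: val_inj.
rewrite !normrM r23_icomb.
have H0 : H%:R != 0 :> algC by rewrite pnatr_eq0.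
have -> : ((32 * B ^ 2) ^ 2)%N%:R = ((8 * B)%N%:R / H%:R) * ((8 * B)%N%:R / H%:R) *
    ((4 * B * H)%N%:R * (4 * B * H)%N%:R) :> algC.
  by rewrite !(natrX, natrM); field.
have hc := icomb_bound i2 wB cH.
by rewrite !ler_pM ?mulr_ge0 //; apply: ltW; apply: cs.
Qed.

Definition dominates (c c' : {ffun 'I_4 -> int}) : bool :=
  (r i0 c < r i0 c') && (r i1 c < r i1 c').

Lemma dominates_trans : transitive dominates.
Proof.
move=> b a c /andP[a0 a1] /andP[b0 b1].
by rewrite /dominates (lt_trans a0 b0) (lt_trans a1 b1).
Qed.

(** The norm bound T does not depend on the length of the chain, hence the
    pigeonhole principle applies to long chains. *)
Lemma dominating_chain : exists T : nat, forall n : nat,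
  exists s : seq {ffun 'I_4 -> int}, [/\ size s = n, sorted dominates s
    & {in s, forall c, icomb c != 0 /\ `|\prod_j phi (h j (icomb c))| <= T%:R}].
Proof.
have [T HT] := small_icomb_exists; exists T.
elim=> [|n [s [sz ss sT]]]; first by exists [::].
have [e0 [e1 [p0 p1 he]]] : exists e0 e1 : algC, [/\ 0 < e0, 0 < e1
    & forall c, r i0 c < e0 -> r i1 c < e1 -> sorted dominates (c :: s)].
  case: s ss sT {sz} => [|d s] ss sT; first by exists 1, 1; split; rewrite ?ltr01.
  have [d0 _] := sT d (mem_head _ _).
  exists (r i0 d), (r i1 d); split; rewrite ?normr_gt0 ?fmorph_eq0 // => c c0 c1.
  by apply/andP; split; first exact/andP.
have [c [c0 cr0 cr1 cT]] := HT e0 e1 p0 p1.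
exists (c :: s); split; [by rewrite /= sz | exact: he |].
by move=> d; rewrite inE => /predU1P[->|/sT].
Qed.

(** Take D = T!, a multiple of all norms in the chain.  A chain longer than the
    number of residue classes modulo D contains two congruent members. *)
Lemma congruent_pair_exists : exists D : int, exists c c' : {ffun 'I_4 -> int},
  [/\ dominates c c', icomb c != 0 /\ icomb c' != 0,
      exists z, icomb c - icomb c' = D%:~R * icomb z
    & D%:~R / phi (icomb c) \in Aint /\ D%:~R / phi (icomb c') \in Aint].
Proof.
have [T HT] := dominating_chain.
have [m em] : exists m, T`! = m.+1 by exists T`!.-1; rewrite prednK ?fact_gt0.
pose D : int := m.+1%:Z.
pose cls (c : {ffun 'I_4 -> int}) : {ffun 'I_4 -> 'I_m.+1} :=
  [ffun i => inord `|(c i %% D)%Z|%N].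
have [s [sz ss sT]] := HT #|{ffun 'I_4 -> 'I_m.+1}|.+1.
have nu : ~~ uniq (map cls s).
  apply/negP=> /card_uniqP; rewrite size_map sz => e.
  by have := max_card (mem (map cls s)); rewrite e ltnn.
have /(uniqPn (cls 0))[i [j [lij]]] := nu; rewrite size_map => lj.
have li := ltn_trans lij lj.
rewrite !(nth_map 0) // => ecls.
have := sorted_ltn_nth dominates_trans 0 ss i j li lj lij.
have [ci0 ciT] := sT _ (mem_nth 0 li); have [cj0 cjT] := sT _ (mem_nth 0 lj).
move: (nth 0 s i) (nth 0 s j) ecls ci0 ciT cj0 cjT => c c' ecls c0 cT c'0 c'T dcc'.
have modN k : (`|(k %% D)%Z| < m.+1)%N.
  by rewrite -ltz_nat gez0_abs ?modz_ge0 // ltz_pmod.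
have divD i' : (D %| c i' - c' i')%Z.
  rewrite -eqz_mod_dvd; have /ffunP/(_ i') := ecls.
  rewrite !ffunE => /(congr1 val); rewrite /= !inordK ?modN // => e.
  by apply/eqP; rewrite -[LHS]gez0_abs ?modz_ge0 // e gez0_abs ?modz_ge0.
have Adiv d : icomb d != 0 -> `|\prod_j phi (h j (icomb d))| <= T%:R ->
    D%:~R / phi (icomb d) \in Aint.
  move=> d0 dT; have [n en] := gal_norm_int (icombK d) (icombA d).
  have nA := norm_div_Aint (icombK d) (icombA d) d0 en.
  have nT : (`|n|%N <= T)%N by rewrite -(ler_nat algC) natr_absz intr_norm en.
  have n0 : (0 < `|n|)%N.
    rewrite absz_gt0 -(intr_eq0 algC) en; apply/prodf_neq0 => l _.
    by rewrite !fmorph_eq0.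
  have /dvdzP[q eq] : (n %| D)%Z by rewrite /D -em dvdzE dvdn_fact // n0.
  by rewrite eq intrM -mulrA rpredM ?Aint_int.
exists D, c, c'; split=> //; last by split; apply: Adiv.
exists [ffun l => ((c l - c' l) %/ D)%Z]; rewrite -icombB /icomb mulr_sumr.
apply: eq_bigr => l _; rewrite !ffunE mulrA -intrM; congr (_%:~R * _).
by rewrite mulrC divzK.
Qed.

End Pigeonhole.

(** If y - y' = D z and D is a multiple of the norms of y and y', then
    y' / y = 1 - z (D / y) and y / y' = 1 + z (D / y') are algebraic integers. *)
Lemma unit_exists : exists a, [/\ alg_unit phi K a, 1 < `|phi (h i0 a)| & 1 < `|phi (h i1 a)|].
Proof.
have [w [wK wA wfree]] := int_basis_exists.
have [D [c [c' [dcc' [c0 c'0] [z ez] [cA c'A]]]]] := congruent_pair_exists wK wA wfree.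
set y := icomb w c in c0 ez cA; set y' := icomb w c' in c'0 ez c'A.
have yK : y \in K by apply: icombK.
have y'K : y' \in K by apply: icombK.
have zA : phi (icomb w z) \in Aint by apply: icombA.
have [d0 d1] := andP dcc'.
exists (y' / y); split.
- split; first by rewrite rpred_div.
    have -> : y' / y = 1 - D%:~R * icomb w z / y by rewrite -ez; field.
    rewrite rmorphB rmorph1 !rmorphM /= rmorph_int fmorphV mulrAC.
    by rewrite rpredB ?rpred1 // rpredM.
  exists (y / y'); split; first by rewrite rpred_div.
    have -> : y / y' = 1 + D%:~R * icomb w z / y' by rewrite -ez; field.
    rewrite rmorphD rmorph1 !rmorphM /= rmorph_int fmorphV mulrAC.
    by rewrite rpredD ?rpred1 // rpredM.
  by field; rewrite c0 c'0.
- by rewrite !rmorphM !fmorphV normrM normfV ltr_pdivlMr ?mul1r // normr_gt0 !fmorph_eq0.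
- by rewrite !rmorphM !fmorphV normrM normfV ltr_pdivlMr ?mul1r // normr_gt0 !fmorph_eq0.
Qed.

End Unit.

(** * The symmetric case and conclusion *)

Section SymmetricCase.
Variables (L : splittingFieldType rat) (phi : {rmorphism L -> algC}).
Variables (K E : {subfield L}) (galE : galois 1 E) (sKE : (K <= E)%VS).
Hypothesis dimK : \dim K = 4%N.
Variables (h : 'I_4 -> gal_of E) (hP : embeddings phi K h).
Hypothesis full : forall s : 'S_4, exists g, acts_as K h g s.

Local Notation r i x := `|phi (h i x)|.

Lemma S4_trans2 (i j : 'I_4) : i != j -> exists s : 'S_4, s i0 = i /\ s i1 = j.
Proof.
move=> nij; pose t := tperm i0 i; exists (t * tperm (t i1) j)%g.
have tj : t (t j) = j by rewrite tpermK.
rewrite !permM tpermL; split; last by rewrite tpermL.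
by rewrite tpermD // 1?eq_sym // -{1}(tpermL i0 i) -/t (inj_eq perm_inj).
Qed.

(** It remains to order the two real conjugates, which explains the index i.
    They differ in absolute value: otherwise a^2 has the same image under h_0 and
    h_1, hence under h_0 and h_2 as well, and then the norm of a exceeds 1. *)
Lemma expanding_unit a u : a \in K -> phi a \in Aint -> phi u \in Aint -> u \in K ->
  a * u = 1 -> 1 < r i0 a -> 1 < r i1 a ->
  exists i, wandering (phi (h i a)).
Proof.
move=> aK aA uA uK au a0 a1.
have [cov inj hreal hconj] := hP.
have hE i x : x \in K -> h i x \in E by move=> xK; rewrite memv_gal ?(subvP sKE).
have hA i x : x \in K -> phi x \in Aint -> phi (h i x) \in Aint.
  by move=> xK xA; rewrite (Aint_gal phi galE) ?(subvP sKE).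
have r23 : r i3 a = r i2 a by rewrite hconj // norm_conjC.
have [n en] := gal_norm_int galE sKE hP aK aA.
have [m em] := gal_norm_int galE sKE hP uK uA.
have nm : n * m = 1.
  apply/eqP; rewrite -(eqr_int algC) intrM en em -big_split /=; apply/eqP.
  by apply: big1 => i _; rewrite -!rmorphM au !rmorph1.
have n1 : `|n| = 1.
  have /eqP := congr1 absz nm; rewrite abszM muln_eq1 => /andP[/eqP n1 _].
  by rewrite -abszE n1.
have N1 : r i0 a * r i1 a * r i2 a * r i3 a = 1.
  transitivity (`|n%:~R| : algC); last by rewrite -intr_norm n1.
  rewrite en normr_prod !big_ord_recl big_ord0 mulr1 !mulrA.
  by congr (`|phi (h _ _)| * `|phi (h _ _)| * `|phi (h _ _)| * `|phi (h _ _)|); apply: val_inj.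
have ne : r i0 a != r i1 a.
  apply/eqP=> e.
  have e2 : h i0 (a ^+ 2) = h i1 (a ^+ 2).
    apply: (fmorph_inj phi); rewrite !rmorphXn /=.
    by rewrite -[LHS]real_normK ?hreal // e real_normK ?hreal.
  have [s [s0 s1]] := @S4_trans2 i0 i2 isT; have [g gP] := full s.
  have e3 : h i0 (a ^+ 2) = h i2 (a ^+ 2).
    by rewrite -{1}s0 -s1 -!gP ?rpredX // e2.
  have : r i0 a ^+ 2 = r i2 a ^+ 2.
    by move: e3 => /(congr1 (fun x => `|phi x|)); rewrite !rmorphXn !normrX.
  move/eqP; rewrite eqrXn2 // => /eqP e4.
  move: N1; rewrite r23 -e4 -e => p.
  have : 1 < r i0 a ^+ 4 by rewrite exprn_egt1.
  by rewrite !exprS expr0 mulr1 !mulrA p ltxx.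
have big i : real_index i -> 1 < r i a by elim/I4_ind: i.
have key (p : 'S_4) : p i2 = i2 -> p i3 = i3 ->
    (forall i, real_index i -> real_index (p i)) ->
    r (p i0) a * r (p i1) a = r i0 a * r i1 a -> r (p i1) a < r (p i0) a ->
    wandering (phi (h (p i0) a)).
  move=> p2 p3 rp p01 lt; apply: (expanding_wandering galE (v := fun i => h (p i) a)).
  split=> //.
  - by move=> i; apply: hE.
  - by move=> i; apply: hA.
  - by rewrite p01 p2 p3.
  - move=> i j ij; have [s [s0 s1]] := S4_trans2 ij.
    have [g gP] := full (p^-1 * s * p)%g; exists g.
    by rewrite !gP // !permM !permK s0 s1.
  - move=> g; have [s sP] := acts_as_exists sKE hP g.
    exists (p * s * p^-1)%g => i; rewrite sP // !permM.
    by rewrite permKV.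
  - by move=> i ri; apply: hreal => //; apply: rp.
  - by rewrite p2 p3.
  - by apply: big; apply: rp.
have [lt|lt|e] := real_ltgtP (normr_real (phi (h i0 a))) (normr_real (phi (h i1 a))).
- exists i1; have := key (tperm i0 i1); rewrite !tpermL !tpermR !tpermD //; apply=> //.
    by move=> i; elim/I4_ind: i => // _; rewrite ?tpermL ?tpermR.
  by rewrite mulrC.
- by exists i0; have := key 1%g; rewrite !perm1; apply => // i; rewrite perm1.
- by rewrite e eqxx in ne.
Qed.
End SymmetricCase.

Theorem proposition3p4 (L : splittingFieldType rat)
    (iota : {rmorphism L -> algC}) (K E : {subfield L})
    (dimK : \dim K = 4%N) (sigK : has_signature (subvs_of K) 2 1)
    (clKE : is_galois_closure K E) :
  ((forall a : L, a \in K -> preperiodic (iota a)) <->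
     'Gal(E / 1%AS) \isog 'D_8) /\
  (~ 'Gal(E / 1%AS) \isog 'D_8 ->
     exists a : L, alg_unit iota K a /\ wandering (iota a)).
Proof.
have [sKE galE minE] := clKE.
have [h hP] := embeddings_exist iota galE sKE sigK.
have [A [isoA Atr At memA actA]] := galois_perm_group galE sKE hP minE.
have wander : ~ 'Gal(E / 1%AS) \isog 'D_8 ->
    exists a : L, alg_unit iota K a /\ wandering (iota a).
  move=> nD8; have [fullA|[_ AD8]] := S4_or_D8 Atr At; last first.
    by case: nD8; apply: isog_trans isoA AD8.
  have full s : exists g, acts_as K h g s by apply: actA; rewrite fullA inE.
  have [a [ua a0 a1]] := unit_exists galE sKE dimK hP.
  have [aK aA [u [uK uA au]]] := ua.
  have [i wi] := expanding_unit galE sKE hP full aK aA uA uK au a0 a1.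
  exists a; split=> // pa; apply: wi.
  apply: preperiodic_mahler; rewrite (mahler_gal iota galE) ?(subvP sKE) //.
  exact: preperiodicM.
split=> //; split=> [pK|D8 a aK].
  have [//|/negP nD8] := boolP ('Gal(E / 1%AS) \isog 'D_8).
  have [a [[aK _ _] wa]] := wander nD8.
  by case: (wa (pK a aK)).
have AD8 : A \isog 'D_8 by rewrite isog_sym in isoA; apply: isog_trans isoA D8.
apply: (preperiodic_K galE sKE dimK hP) => // g.
have [s sA sP] := memA g; exists s => //.
have [fullA|[blocks _]] := S4_or_D8 Atr At; last exact: blocks.
have := card_isog AD8; rewrite card_D8 fullA cardsT card_Sn.
by [].
Qed.
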